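(* Let $F$ be a distribution function on $[0,1]$ (so $F(0)=0$, $F(1)=1$) admitting a density $f$ that is continuous and strictly positive on $[0,1]$. For $n\ge2$ let $P_n$ be the uniform distribution on $\Delta_n$, and let $Q_n$ be the law on $\Delta_n$ of the vector of gaps $q=(q_1,\dots,q_n)$, $q_i=X_{(i)}-X_{(i-1)}$, between the order statistics $X_{(1)}<\cdots<X_{(n-1)}$ of i.i.d. random variables $X_1,\dots,X_{n-1}$ with distribution function $F$, where $X_{(0)}=0$ and $X_{(n)}=1$. Then $$\limsup_{n\to\infty}\mathbf{C}(P_n,Q_n)\le\int_0^1f(u)\log f(u)\,du .$$
   Context: $\Delta_n=\{p\in(0,1)^n:\sum_ip_i=1\}$. For $p,q\in\Delta_n$, $c(p,q)=\log\left(\frac1n\sum_{i=1}^n\frac{q_i}{p_i}\right)-\frac1n\sum_{i=1}^n\log\frac{q_i}{p_i}$. For Borel probability measures $P,Q$ on $\Delta_n$, $\mathbf{C}(P,Q)=\inf_R\mathbb{E}_{(p,q)\sim R}[c(p,q)]$, the infimum being over all couplings $R$ of $P$ and $Q$. *)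

(* Defs.v *)
From HB Require Import structures.
From mathcomp Require Import all_boot all_order all_algebra.
From mathcomp Require Import all_classical all_reals all_analysis.
From mathcomp Require Import measurable_realfun.

Set Implicit Arguments.
Unset Strict Implicit.
Unset Printing Implicit Defensive.

Import Order.TTheory GRing.Theory Num.Theory.
Import numFieldNormedType.Exports.

Local Open Scope classical_set_scope.
Local Open Scope ring_scope.

Section simplex.
Context {R : realType}.

Definition simplex (n : nat) : set (n.-tuple R) :=
  [set p | (forall i, 0 < tnth p i < 1) /\ \sum_(i < n) tnth p i = 1].

Definition cost (n : nat) (p q : n.-tuple R) : R :=
  ln (n%:R^-1 * \sum_(i < n) tnth q i / tnth p i)
  - n%:R^-1 * \sum_(i < n) ln (tnth q i / tnth p i).

Lemma measurable_simplex (n : nat) : measurable (@simplex n).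
Proof.
have -> : @simplex n = \bigcap_(i in [set: 'I_n])
    ((fun p => tnth p i) @^-1` `]0, 1[) `&`
    (fun p : n.-tuple R => \sum_(i < n) tnth p i) @^-1` [set 1].
  apply/seteqP; split => p /=.
    by move=> [h s]; split => // i _ /=; rewrite in_itv /=.
  by move=> [h s]; split => // i; have := h i I; rewrite /= in_itv.
apply: measurableI.
  apply: fin_bigcap_measurable; first exact: finite_finset.
  move=> i _; rewrite -[X in measurable X]setTI.
  exact: measurable_tnth.
rewrite -[X in measurable X]setTI.
have h : measurable_fun setT (fun p : n.-tuple R => \sum_(i < n) tnth p i).
  by apply: measurable_sum => i; exact: measurable_tnth.
exact: h.
Qed.

End simplex.

Section transport.
Context {R : realType}.

Definition couplings d1 d2 (T1 : measurableType d1) (T2 : measurableType d2)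
    (P : probability T1 R) (Q : probability T2 R) :
    set (probability (T1 * T2)%type R) :=
  [set rho |
    (forall A, measurable A -> pushforward rho fst A = P A) /\
    (forall B, measurable B -> pushforward rho snd B = Q B)].

(* A probability measure on the simplex is represented by a probability measure
   on R^n giving it mass 1.  Every coupling of two such measures is carried by
   simplex `*` simplex; integrating over that set keeps the junk values of ln
   and of division out of the cost. *)
Definition transport_cost (n : nat) (P Q : probability (n.-tuple R) R) : \bar R :=
  ereal_inf [set (\int[rho]_(z in @simplex R n `*` @simplex R n)
                    (cost z.1 z.2)%:E)%E | rho in couplings P Q].

End transport.

Section image_measure.
Context d d' (T : measurableType d) (T' : measurableType d') (R : realType).
Variables (mu : {measure set T -> \bar R}) (phi : {mfun T >-> T'}).

Definition image_measure : set T' -> \bar R := pushforward mu phi.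

Let image_measure0 : image_measure set0 = 0%E.
Proof. exact: measure0. Qed.

Let image_measure_ge0 A : (0 <= image_measure A)%E.
Proof. exact: measure_ge0. Qed.

Let image_measure_sigma_additive : semi_sigma_additive image_measure.
Proof. exact: measure_semi_sigma_additive. Qed.

HB.instance Definition _ := isMeasure.Build _ _ _ image_measure
  image_measure0 image_measure_ge0 image_measure_sigma_additive.

End image_measure.

Section uniform.
Context {R : realType}.

(* measurableTypeR R, the domain of lebesgue_measure, has the same measurable
   sets as the canonical structure on R but another display. *)
Definition cons_pair (m : nat) (z : m.-tuple R * measurableTypeR R) :
    m.+1.-tuple R :=
  [the m.+1.-tuple R of z.2 :: z.1].

Lemma measurable_cons_pair (m : nat) : measurable_fun setT (@cons_pair m).
Proof.
apply: (@measurable_cons _ _ _ R (fun z => z.2 : R)) => //.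
exact: (@measurable_snd _ _ (m.-tuple R) (measurableTypeR R)).
Qed.

HB.instance Definition _ (m : nat) :=
  isMeasurableFun.Build _ _ _ _ (@cons_pair m) (@measurable_cons_pair m).

Fixpoint lebesgue_tuple (m : nat) : {measure set (m.-tuple R) -> \bar R} :=
  match m with
  | 0 => [the {measure set (0.-tuple R) -> \bar R} of dirac [tuple]]
  | k.+1 => [the {measure set (k.+1.-tuple R) -> \bar R} of
      image_measure (lebesgue_tuple k \x (@lebesgue_measure R))%E (@cons_pair k)]
  end.

(* Parametrises the hyperplane of equation \sum_i p_i = 1 by its first m
   coordinates; the image of Lebesgue measure is, up to a constant factor, the
   surface measure of the hyperplane. *)
Definition chart (m : nat) (x : m.-tuple R) : m.+1.-tuple R :=
  [the m.+1.-tuple R of rcons x (1 - \sum_(i < m) tnth x i)].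

Lemma measurable_chart (m : nat) : measurable_fun setT (@chart m).
Proof.
apply/measurable_fun_tnthP => i.
have [im|im] := ltnP i m.
  rewrite (_ : _ \o _ = fun x => tnth x (Ordinal im)); last first.
    by apply/funext => x /=; rewrite !(tnth_nth 0) /= nth_rcons size_tuple im.
  exact: measurable_tnth.
rewrite (_ : _ \o _ = fun x : m.-tuple R => 1 - \sum_(i < m) tnth x i); last first.
  apply/funext => x /=; rewrite (tnth_nth 0) /= nth_rcons size_tuple ltnNge im /=.
  by rewrite eqn_leq im -ltnS ltn_ord.
apply: measurable_funB => //.
by apply: measurable_sum => j; exact: measurable_tnth.
Qed.

HB.instance Definition _ (m : nat) :=
  isMeasurableFun.Build _ _ _ _ (@chart m) (@measurable_chart m).

Definition simplex_volume (m : nat) : {measure set (m.+1.-tuple R) -> \bar R} :=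
  [the {measure set (m.+1.-tuple R) -> \bar R} of
    mrestr (image_measure (lebesgue_tuple m) (@chart m))
           (@measurable_simplex R m.+1)].

Definition cube (m : nat) (b : R) : set (m.-tuple R) :=
  [set x | forall i, 0 < tnth x i < b].

Lemma measurable_cube (m : nat) (b : R) : measurable (@cube m b).
Proof.
have -> : @cube m b = \bigcap_(i in [set: 'I_m])
    ((fun x => tnth x i) @^-1` `]0, b[).
  apply/seteqP; split => x /= h i; first by move=> _ /=; rewrite in_itv /=.
  by have := h i I; rewrite /= in_itv.
apply: fin_bigcap_measurable; first exact: finite_finset.
by move=> i _; rewrite -[X in measurable X]setTI; exact: measurable_tnth.
Qed.

Lemma lebesgue_cube (m : nat) (b : R) : 0 < b ->
  lebesgue_tuple m (@cube m b) = (b ^+ m)%:E.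
Proof.
move=> b0; elim: m => [|m IH].
  rewrite /= diracE mem_set ?expr0 //; by case.
rewrite [LHS]/= /image_measure /pushforward.
have -> : @cons_pair m @^-1` @cube m.+1 b = @cube m b `*` `]0, b[.
  apply/seteqP; split => -[x y] /=.
    move=> h; split; last by have := h ord0; rewrite in_itv.
    by move=> i; have := h (lift ord0 i); rewrite tnthS.
  move=> [h]; rewrite in_itv /= => hy i; case: (unliftP ord0 i) => [j|] ->.
    by rewrite tnthS; exact: h.
  by [].
rewrite product_measure1E//; last exact: measurable_cube.
transitivity (lebesgue_tuple m (cube b) * lebesgue_measure `]0%R, b[)%E => //.
by rewrite IH lebesgue_measure_itv /= lte_fin b0 oppr0 adde0 -EFinM -exprSr.
Qed.

Lemma simplex_volume_gt0_lty (m : nat) :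
  (0 < simplex_volume m.+1 [set: m.+2.-tuple R] < +oo)%E.
Proof.

rewrite /simplex_volume /= /mrestr setTI /image_measure /pushforward.
set D := _ @^-1` _.
have mD : measurable D.
  by rewrite -[X in measurable X]setTI; apply: measurable_chart => //; exact: measurable_simplex.
have chartE (x : m.+1.-tuple R) (i : 'I_m.+1) :
    tnth (chart x) (widen_ord (leqnSn _) i) = tnth x i.
  by rewrite !(tnth_nth 0) /= nth_rcons size_tuple ltn_ord.
have chart_max (x : m.+1.-tuple R) :
    tnth (chart x) ord_max = 1 - \sum_(i < m.+1) tnth x i.
  by rewrite (tnth_nth 0) /= nth_rcons size_tuple ltnn eqxx.
apply/andP; split; last first.
  apply: (@le_lt_trans _ _ (lebesgue_tuple m.+1 (@cube m.+1 1))).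
    apply: le_measure; rewrite ?inE//; first exact: measurable_cube.
    by move=> x [h _] i; have := h (widen_ord (leqnSn _) i); rewrite chartE.
  by rewrite lebesgue_cube// ltry.
pose b : R := m.+2%:R^-1.
have b0 : 0 < b by rewrite invr_gt0.
apply: (@lt_le_trans _ _ (lebesgue_tuple m.+1 (@cube m.+1 b))).
  by rewrite lebesgue_cube// lte_fin exprn_gt0.
apply: le_measure; rewrite ?inE//; first exact: measurable_cube.
move=> x h; have hs0 : 0 < \sum_(i < m.+1) tnth x i.
  rewrite big_ord_recl ltr_pwDl//; first by have /andP[] := h ord0.
  by apply: sumr_ge0 => i _; have /andP[/ltW] := h (lift ord0 i).
have hs1 : \sum_(i < m.+1) tnth x i < 1.
  apply: (@le_lt_trans _ _ (\sum_(i < m.+1) b)).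
    by apply: ler_sum => i _; have /andP[_ /ltW] := h i.
  by rewrite sumr_const card_ord -mulr_natl ltr_pdivrMr// mul1r ltr_nat.
have b1 : b <= 1 by rewrite invf_le1// ler1n.
split => /=.
  move=> i; have [im|im] := ltnP i m.+1.
    rewrite (_ : i = widen_ord (leqnSn _) (Ordinal im)); last exact: val_inj.
    by rewrite chartE; have /andP[-> /lt_le_trans->] := h (Ordinal im).
  rewrite (_ : i = ord_max); last first.
    by apply: val_inj => /=; apply/eqP; rewrite eqn_leq im -ltnS ltn_ord.
  by rewrite chart_max subr_gt0 hs1 ltrBlDr ltrDl hs0.
rewrite big_ord_recr /= chart_max.
by under eq_bigr do rewrite chartE; rewrite addrC subrK.
Qed.

(* The Dirac mass only makes mnormalize total; simplex_volume_gt0_lty shows that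
   it is not used as soon as the simplex has at least two coordinates. *)
Definition uniform_simplex (m : nat) : probability (m.+1.-tuple R) R :=
  [the probability (m.+1.-tuple R) R of
    mnormalize (simplex_volume m) \d_[tuple of nseq m.+1 (m.+1%:R^-1 : R)]].

Lemma uniform_simplexE (m : nat) (A : set (m.+2.-tuple R)) :
  uniform_simplex m.+1 A = (simplex_volume m.+1 A *
    (fine (simplex_volume m.+1 [set: m.+2.-tuple R]))^-1%:E)%E.
Proof.
have /andP[v0 voo] := simplex_volume_gt0_lty m.
by rewrite [LHS]/= /mnormalize gt_eqF//= lt_eqF.
Qed.

End uniform.

Section gaps.
Context {R : realType}.

(* Index 0 is 0, index m.+1 is 1, and index k with 1 <= k <= m is the k-th
   smallest entry of x. *)
Definition order_stat (m : nat) (x : m.-tuple R) (k : nat) : R :=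
  nth 0 (0 :: rcons (sort <=%R x) 1) k.

Definition gaps (m : nat) (x : m.-tuple R) : m.+1.-tuple R :=
  [tuple order_stat x i.+1 - order_stat x i | i < m.+1].

Lemma measurable_nth_sort (m k : nat) :
  measurable_fun setT (fun x : m.-tuple R => nth 0 (sort <=%R x) k).
Proof.
have [mk|km] := leqP m k.
  rewrite (_ : (fun _ => _) = cst 0) //; apply/funext => x /=.
  by rewrite nth_default// size_sort size_tuple.
apply: (measurability (@RGenCInfty.G R)) => [|/= _ [_] [r] -> <-].
  exact: RGenCInfty.measurableE.
rewrite setTI.
pose N (x : m.-tuple R) : R := \sum_(i < m) ((tnth x i < r)%R)%:R.
have mN : measurable_fun setT N.
  apply: measurable_sum => i.
  rewrite (_ : (fun _ => _) =
    (fun x : m.-tuple R => if tnth x i < r then 1 else 0 : R)); last first.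
    by apply/funext => x; case: ifP.
  apply: measurable_fun_ifT => //.
  by apply: measurable_fun_ltr => //; exact: measurable_tnth.
have NE x : N x = (count (< r) x)%:R.
  rewrite /N -natr_sum -sum1_count big_tuple; congr (_%:R).
  by rewrite [RHS]big_mkcond; apply: eq_bigr => i _; case: ifP => /= ->.
rewrite (_ : _ @^-1` _ = N @^-1` `]-oo, k%:R]).
  by rewrite -[X in measurable X]setTI; exact: mN.
apply/seteqP; split => x /=; rewrite !in_itv /= ?andbT NE ler_nat.
- rewrite -(count_sort <=%R) => rx; rewrite leqNgt; apply/negP => kc.
  have /(nth_count_lt 0 (sort_le_sorted x)) := kc.
  by rewrite ltNge rx.
- rewrite -(count_sort <=%R) => ck; apply: nth_count_ge; first exact: sort_le_sorted.
  by rewrite ck size_sort size_tuple.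
Qed.

Lemma measurable_order_stat (m k : nat) :
  measurable_fun setT (fun x : m.-tuple R => order_stat x k).
Proof.
case: k => [|k]; first exact: measurable_cst.
rewrite /order_stat /=.
have [km|] := ltnP k m.
  rewrite (_ : (fun _ => _) = (fun x : m.-tuple R => nth 0 (sort <=%R x) k)).
    exact: measurable_nth_sort.
  by apply/funext => x; rewrite nth_rcons size_sort size_tuple km.
move=> mk; rewrite (_ : (fun _ => _) = cst (if k == m then 1 else 0)) //.
apply/funext => x; rewrite nth_rcons size_sort size_tuple /=.
by rewrite ltnNge mk.
Qed.

Lemma measurable_gaps (m : nat) : measurable_fun setT (@gaps m).
Proof.
apply/measurable_fun_tnthP => i.
rewrite (_ : _ \o _ = fun x => order_stat x i.+1 - order_stat x i); last first.
  by apply/funext => x /=; rewrite tnth_mktuple.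
by apply: measurable_funB; exact: measurable_order_stat.
Qed.

HB.instance Definition _ (m : nat) :=
  isMeasurableFun.Build _ _ _ _ (@gaps m) (@measurable_gaps m).

End gaps.

Section sample.
Context {R : realType} d (Omega : measurableType d) (Pr : probability Omega R).

Definition independent_RVs (I : finType) (X : I -> {RV Pr >-> R}) : Prop :=
  forall (J : {set I}) (B : I -> set R), (forall i, measurable (B i)) ->
    Pr (\bigcap_(i in [set` J]) (X i @^-1` B i)) =
    (\prod_(i in J) Pr (X i @^-1` B i))%E.

(* When F 0 = 0 and F 1 = 1, the values of the distribution function on [0, 1]
   determine the common law of the X i, which is then carried by [0, 1]. *)
Definition iid_with_cdf01 (I : finType) (X : I -> {RV Pr >-> R}) (F : R -> R) :=
  independent_RVs X /\
  forall i x, x \in `[0, 1] -> cdf (X i) x = (F x)%:E.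

Variables (m : nat) (X : 'I_m -> {RV Pr >-> R}).

Definition sample (w : Omega) : m.-tuple R := [tuple X i w | i < m].

Lemma measurable_sample : measurable_fun setT sample.
Proof.
apply/measurable_fun_tnthP => i.
rewrite (_ : _ \o _ = X i); first exact: measurable_funPT.
by apply/funext => x /=; rewrite tnth_mktuple.
Qed.

HB.instance Definition _ :=
  isMeasurableFun.Build _ _ _ _ sample measurable_sample.

(* Ties and values outside ]0, 1[ put the gap vector off the simplex; when the
   X i are i.i.d. with a density on [0, 1] this is a null event. *)
Definition gap_law : probability (m.+1.-tuple R) R :=
  [the probability (m.+1.-tuple R) R of
    distribution Pr [the {mfun Omega >-> m.+1.-tuple R} of
      (@gaps R m \o sample)]].

End sample.

(* Main.v *)
From HB Require Import structures.
Require Import Defs.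
From mathcomp Require Import all_boot all_order all_algebra.
From mathcomp Require Import perm.
From mathcomp Require Import all_classical all_reals all_analysis.
From mathcomp Require Import measurable_realfun.
From mathcomp Require Import zify lra ring.

Set Implicit Arguments.
Unset Strict Implicit.
Unset Printing Implicit Defensive.

Import Order.TTheory GRing.Theory Num.Theory.
Import numFieldNormedType.Exports.

Local Open Scope classical_set_scope.
Local Open Scope ring_scope.

(** The two laws are coupled monotonically. Let U be the tuple of the F(X_i):
its entries are independent and uniform, so the vector p of its gaps is uniform
on the simplex ([uniform_simplex_gaps]), while the vector q of the gaps of X has
the second law ([monotone_coupling_couples]).

For this coupling p_i / q_i is a slope of F over the i-th cell cut out by the
sample, hence a value f(xi_i) with xi_i in that cell. Bounding the logarithm of
the mean of the q_i / p_i by ln A <= A - 1 turns the cost into at most the mean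
over the cells of excess(xi_i), where excess = 1/f - 1 + ln f >= 0. By uniform
continuity, moving xi_i to the right end of its cell costs at most e plus C
times the length of the cell. The lengths add up to 1 and the right ends are the
sample points and 1, so for a sample of size N - 1 the cost is at most
      (sum_j excess(X_j) + excess(1) + C) / N + e
([cost_monotone_coupling]). This bound involves the sample only through a
symmetric sum: its expectation needs the law of a single X_j, and no asymptotics
of order statistics. Since E excess(X_j) is the integral of
f * excess = 1 - f + f ln f, that is of f ln f ([expectation_density],
[integral_excess]), letting N tend to infinity and then e to 0 gives the bound.

That the gaps of a uniform sample are uniform on the simplex is proved by
cutting the cube into chambers according to the order of the coordinates. The
chambers are exchanged by the permutations of the coordinates, which preserve
the uniform law, so each contributes the same amount
([uniform_cube_gaps]). On the decreasing chamber, the map from the gaps to the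
sample is, up to a permutation, a suffix sum, and suffix sums preserve Lebesgue
measure ([lebesgue_tuple_suffix_sums]). Ties being null, the chambers carry the
whole mass, which settles the normalisation. *)

(** * Measures on tuples and boxes *)

Section boxes.
Context {R : realType}.

Definition box (m : nat) (B : 'I_m -> set R) : set (m.-tuple R) :=
  [set x | forall i, B i (tnth x i)].

Lemma boxE (m : nat) (B : 'I_m -> set R) :
  box B = \bigcap_(i in [set: 'I_m]) ((fun x => tnth x i) @^-1` B i).
Proof. by apply/seteqP; split => x h i; [move=> _|]; exact: (h i). Qed.

Lemma measurable_box (m : nat) (B : 'I_m -> set R) :
  (forall i, measurable (B i)) -> measurable (box B).
Proof.
move=> mB; rewrite boxE; apply: fin_bigcap_measurable; first exact: finite_finset.
by move=> i _; rewrite -[X in measurable X]setTI; exact: measurable_tnth.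
Qed.

Definition boxes (m : nat) : set (set (m.-tuple R)) :=
  [set A | exists2 B : 'I_m -> set R, (forall i, measurable (B i)) & A = box B].

Lemma measurable_tuple_boxE (m : nat) :
  @measurable _ (m.-tuple R) = <<s (@boxes m) >>.
Proof.
apply/seteqP; split; last first.
  apply: smallest_sub; first exact: sigma_algebra_measurable.
  by move=> A [B mB ->]; exact: measurable_box.
apply: smallest_sub; first exact: smallest_sigma_algebra.
rewrite -bigcup_seq; apply: bigcup_sub => i _ _ [C mC <-].
apply: sub_sigma_algebra; exists (fun j => if j == i then C else setT).
  by move=> j; case: ifP.
rewrite setTI; apply/seteqP; split => x /=.
  by move=> Cx j; case: eqP => // ->.
by move=> /(_ i); rewrite eqxx.
Qed.

Lemma measure_box_unique (m : nat)
    (mu1 mu2 : {measure set (m.-tuple R) -> \bar R}) :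
  (mu1 setT < +oo)%E ->
  (forall B, (forall i, measurable (B i)) -> mu1 (box B) = mu2 (box B)) ->
  forall A, measurable A -> mu1 A = mu2 A.
Proof.
move=> fin1 mu12 A mA.
apply: (measure_unique (@boxes m) (fun=> setT)) => //.
- exact: measurable_tuple_boxE.
- move=> _ _ [B mB ->] [C mC ->]; exists (fun i => B i `&` C i).
    by move=> i; exact: measurableI.
  apply/seteqP; split => x /=; first by move=> [Bx Cx] i.
  by move=> h; split => i; have [] := h i.
- by move=> _; exists (fun=> setT) => //; apply/seteqP; split.
- by rewrite bigcup_const.
- by move=> _ [B mB ->]; exact: mu12.
Qed.

Lemma lebesgue_tuple_box (m : nat) (B : 'I_m -> set R) :
  (forall i, measurable (B i)) ->
  lebesgue_tuple m (box B) = (\prod_(i < m) @lebesgue_measure R (B i))%E.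
Proof.
elim: m B => [|m IH] B mB.
  by rewrite big_ord0 /= diracE mem_set// => -[].
rewrite big_ord_recl muleC [LHS]/= /image_measure /pushforward.
have -> : @cons_pair R m @^-1` box B = box (fun i => B (lift ord0 i)) `*` B ord0.
  apply/seteqP; split => -[x y] /=.
    move=> h; split; last exact: (h ord0).
    by move=> i; have := h (lift ord0 i); rewrite tnthS.
  move=> [h hy] i; case: (unliftP ord0 i) => [j|] -> //.
  by rewrite tnthS; exact: h.
rewrite product_measure1E; last exact: (mB ord0).
- by rewrite -IH.
- by apply: (@measurable_box m) => i; exact: mB.
Qed.

(** The uniform law on the cube is handled as the restriction of Lebesgue
measure: this keeps it comparable with [simplex_volume], and being finite it is
determined by boxes. *)
Definition uniform_cube (m : nat) : {measure set (m.-tuple R) -> \bar R} :=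
  [the {measure set (m.-tuple R) -> \bar R} of
    mrestr (lebesgue_tuple m) (@measurable_cube R m 1)].

Lemma uniform_cube_box (m : nat) (B : 'I_m -> set R) :
  (forall i, measurable (B i)) ->
  uniform_cube m (box B) = (\prod_(i < m) @lebesgue_measure R (B i `&` `]0%R, 1%R[))%E.
Proof.
move=> mB; rewrite /uniform_cube /= /mrestr.
rewrite -(@lebesgue_tuple_box _ (fun i => B i `&` `]0, 1[%classic)); last first.
  by move=> i; exact: measurableI.
congr (lebesgue_tuple m _); apply/seteqP; split => x /=.
  by move=> [h k] i; split; [exact: h|rewrite /= in_itv /=; exact: k].
by move=> h; split => i; have [] := h i; rewrite //= in_itv.
Qed.

Lemma uniform_cubeT (m : nat) : uniform_cube m setT = 1%E.
Proof. by rewrite /uniform_cube /= /mrestr setTI lebesgue_cube// expr1n. Qed.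

Definition tuple_perm (m : nat) (s : 'S_m) (x : m.-tuple R) : m.-tuple R :=
  [tuple tnth x (s i) | i < m].

Lemma measurable_tuple_perm (m : nat) (s : 'S_m) :
  measurable_fun setT (tuple_perm s).
Proof.
apply/measurable_fun_tnthP => i.
rewrite (_ : _ \o _ = fun x => tnth x (s i)); first exact: measurable_tnth.
by apply/funext => x /=; rewrite tnth_mktuple.
Qed.

HB.instance Definition _ (m : nat) (s : 'S_m) :=
  isMeasurableFun.Build _ _ _ _ (tuple_perm s) (measurable_tuple_perm s).

Lemma uniform_cube_perm (m : nat) (s : 'S_m) (A : set (m.-tuple R)) :
  measurable A -> uniform_cube m (tuple_perm s @^-1` A) = uniform_cube m A.
Proof.
move=> mA; apply/esym.
apply: (@measure_box_unique m (uniform_cube m)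
  [the {measure set _ -> \bar R} of
    image_measure (uniform_cube m) [the {mfun _ >-> _} of tuple_perm s]]) => //.
  by rewrite uniform_cubeT ltry.
move=> B mB; rewrite [RHS]/= /image_measure /pushforward.
have -> : tuple_perm s @^-1` box B = box (fun i => B ((s^-1)%g i)).
  apply/seteqP; split => x h i /=.
    by have := h ((s^-1)%g i); rewrite /= tnth_mktuple permKV.
  by rewrite tnth_mktuple; have := h (s i); rewrite permK.
rewrite !uniform_cube_box// [RHS](reindex_inj (@perm_inj _ s)) /=.
by apply: eq_bigr => i _; rewrite permK.
Qed.

End boxes.

(** * Suffix sums preserve Lebesgue measure *)

Section suffix_sums.
Context {R : realType}.

Definition translation (c : R) (t : measurableTypeR R) : measurableTypeR R := t + c.

Lemma measurable_translation (c : R) : measurable_fun setT (translation c).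
Proof. exact: (@measurable_funD _ R R setT id (cst c)). Qed.

HB.instance Definition _ (c : R) :=
  isMeasurableFun.Build _ _ _ _ (translation c) (measurable_translation c).

Lemma lebesgue_measure_translation (c : R) (A : set (measurableTypeR R)) :
  measurable A -> lebesgue_measure (translation c @^-1` A) = lebesgue_measure A.
Proof.
move=> mA; apply/esym/(@lebesgue_measure_unique _
  [the {measure set (measurableTypeR R) -> \bar R} of
    image_measure lebesgue_measure [the {mfun _ >-> _} of translation c]]) => //.
move=> _ [[a b]] _ <- /=; rewrite /image_measure /pushforward /=.
have -> : translation c @^-1` `]a, b] = `](a - c), (b - c)]%classic.
  by apply/seteqP; split => x; rewrite /translation /= !in_itv /= lerBrDr ltrBlDr.
rewrite !lebesgue_measure_itv /= !lte_fin ltrD2r; case: ifP => // _.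
by rewrite -!EFinB opprB addrA subrK.
Qed.

Definition suffix_sums (m : nat) (y : m.-tuple R) : m.-tuple R :=
  [tuple \sum_(l < m | (i <= l)%N) tnth y l | i < m].

Lemma measurable_suffix_sums (m : nat) : measurable_fun setT (@suffix_sums m).
Proof.
apply/measurable_fun_tnthP => i.
rewrite (_ : _ \o _ = fun x => \sum_(l < m) if (i <= l)%N then tnth x l else 0).
  by apply: measurable_sum => l; case: (i <= l)%N => //; exact: measurable_tnth.
by apply/funext => x /=; rewrite tnth_mktuple big_mkcond.
Qed.

HB.instance Definition _ (m : nat) :=
  isMeasurableFun.Build _ _ _ _ (@suffix_sums m) (@measurable_suffix_sums m).

Lemma suffix_sums_cons (m : nat) (z : m.-tuple R * measurableTypeR R) :
  suffix_sums (cons_pair z) =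
  cons_pair (suffix_sums z.1, translation (\sum_(l < m) tnth z.1 l) z.2).
Proof.
apply: eq_from_tnth => i; rewrite tnth_mktuple.
case: (unliftP ord0 i) => [j|] -> /=.
  rewrite tnthS tnth_mktuple big_mkcond big_ord_recl /= add0r [RHS]big_mkcond.
  by apply: eq_bigr => l _; rewrite tnthS.
rewrite big_ord_recl; congr (_ + _).
by apply: eq_bigr => l _; rewrite tnthS.
Qed.

(** Suffix sums change the head by an amount that depends on the tail only, so
that at each stage of the induction translation invariance on the line is
enough. *)
Lemma lebesgue_tuple_suffix_sums (m : nat) (A : set (m.-tuple R)) :
  measurable A ->
  lebesgue_tuple m (@suffix_sums m @^-1` A) = lebesgue_tuple m A.
Proof.
elim: m A => [|m IH] A mA.
  rewrite (_ : _ @^-1` A = A) //; apply/seteqP.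
  by split => x /=; rewrite (tuple0 x) (tuple0 (suffix_sums _)).
rewrite [LHS]/= [RHS]/= /image_measure /pushforward.
set A' := @cons_pair R m @^-1` A.
have mA' : measurable A'.
  by rewrite -[X in measurable X]setTI; exact: measurable_cons_pair.
rewrite /product_measure1 /=.
pose a := (lebesgue_measure \o xsection A' : _ -> \bar R).
have ma : measurable_fun setT a by exact: measurable_fun_xsection.
(* The section over a tail y is the section over its suffix sums, translated. *)
transitivity (\int[lebesgue_tuple m]_(x in @suffix_sums m @^-1` setT)
    (a \o @suffix_sums m) x)%E.
  apply: eq_integral => y _ /=.
  rewrite /a /= -[RHS](lebesgue_measure_translation (\sum_(l < m) tnth y l)); last first.
    exact: measurable_xsection.
  congr (lebesgue_measure _); apply/seteqP; split => t; rewrite /xsection /= !inE /=.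
    by rewrite suffix_sums_cons.
  by rewrite suffix_sums_cons.
rewrite -(@ge0_integral_pushforward _ _ _ _ R _ (@measurable_suffix_sums m)
  (lebesgue_tuple m) setT) //.
apply: eq_measure_integral => B mB _; exact: IH.
Qed.

End suffix_sums.

(** * Gaps and strictly increasing order statistics *)

Section gaps_simplex.
Context {R : realType}.

Definition knots (m : nat) (x : m.-tuple R) : seq R := 0 :: rcons (sort <=%R x) 1.

Lemma size_knots (m : nat) (x : m.-tuple R) : size (knots x) = m.+2.
Proof. by rewrite /= size_rcons size_sort size_tuple. Qed.

Lemma order_stat0 (m : nat) (x : m.-tuple R) : order_stat x 0 = 0.
Proof. by []. Qed.

Lemma order_stat_max (m : nat) (x : m.-tuple R) : order_stat x m.+1 = 1.
Proof. by rewrite /order_stat /= nth_rcons size_sort size_tuple ltnn eqxx. Qed.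

Lemma order_statS (m : nat) (x : m.-tuple R) (k : nat) : (k < m)%N ->
  order_stat x k.+1 = (sort <=%R x)`_k.
Proof. by move=> km; rewrite /order_stat /= nth_rcons size_sort size_tuple km. Qed.

Lemma sum_gaps (m : nat) (x : m.-tuple R) : \sum_(i < m.+1) tnth (gaps x) i = 1.
Proof.
under eq_bigr do rewrite tnth_mktuple.
rewrite -(big_mkord xpredT (fun i => order_stat x i.+1 - order_stat x i)).
by rewrite telescope_sumr// order_stat_max order_stat0 subr0.
Qed.

Lemma gaps_gt0P (m : nat) (x : m.-tuple R) :
  (forall i, 0 < tnth (gaps x) i) <-> sorted <%R (knots x).
Proof.
split.
- move=> h; apply/(sortedP 0) => i; rewrite size_knots ltnS => im.
  by have := h (Ordinal im); rewrite tnth_mktuple subr_gt0.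
- move=> /(sortedP 0) h i; rewrite tnth_mktuple subr_gt0; apply: h.
  by rewrite size_knots ltnS.
Qed.

Lemma simplexP (m : nat) (p : m.+2.-tuple R) :
  simplex p <-> (forall i, 0 < tnth p i) /\ \sum_(i < m.+2) tnth p i = 1.
Proof.
split; first by move=> [h s]; split => // i; have /andP[] := h i.
move=> [h s]; split => // i; rewrite h /= -s (bigD1 i) //= ltrDl.
(* A second coordinate exists and is positive, so the i-th one is less than 1. *)
pose j : 'I_m.+2 := if i == ord0 then ord_max else ord0.
have ji : j != i.
  by rewrite /j; case: (eqVneq i ord0) => [->|]; rewrite // eq_sym.
rewrite (bigD1 j) //= ltr_pwDl// ?h// sumr_ge0// => l _.
exact: ltW.
Qed.

Lemma simplex_gapsP (m : nat) (x : m.+1.-tuple R) :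
  simplex (gaps x) <-> sorted <%R (knots x).
Proof.
split; first by move/simplexP => -[/gaps_gt0P].
by move=> /gaps_gt0P h; apply/simplexP; split => //; exact: sum_gaps.
Qed.

Lemma gaps_perm (m : nat) (x y : m.-tuple R) : perm_eq x y -> gaps x = gaps y.
Proof.
move=> xy; apply: eq_from_tnth => i; rewrite !tnth_mktuple /order_stat.
suff -> : sort <=%R x = sort <=%R y by [].
by apply/perm_sortP => //; [exact: le_total|exact: le_trans|exact: le_anti].
Qed.

Lemma sorted_knots_uniq (m : nat) (x : m.-tuple R) : sorted <%R (knots x) -> uniq x.
Proof.
move=> /lt_sorted_uniq /= /andP[_]; rewrite rcons_uniq => /andP[_].
by rewrite sort_uniq.
Qed.

Lemma cube_sorted_knots (m : nat) (x : m.-tuple R) :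
  cube 1 x -> uniq x -> sorted <%R (knots x).
Proof.
move=> x01 ux; rewrite /knots /=.
have us : sorted <%R (sort <=%R x) by rewrite sort_lt_sorted.
have s01 t : t \in sort <=%R x -> 0 < t < 1.
  by rewrite mem_sort => /tnthP[i ->]; exact: x01.
rewrite rcons_path; apply/andP; split.
- rewrite path_sortedE; last exact: lt_trans.
  by rewrite us andbT; apply/allP => t /s01 /andP[].
- have : last 0 (sort <=%R x) \in 0 :: sort <=%R x by exact: mem_last.
  by rewrite inE => /predU1P[->|/s01 /andP[]].
Qed.

Lemma tnth_chart_widen (m : nat) (x : m.-tuple R) (i : 'I_m) :
  tnth (chart x) (widen_ord (leqnSn m) i) = tnth x i.
Proof. by rewrite !(tnth_nth 0) /= nth_rcons size_tuple ltn_ord. Qed.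

Lemma tnth_chart_max (m : nat) (x : m.-tuple R) :
  tnth (chart x) ord_max = 1 - \sum_(i < m) tnth x i.
Proof. by rewrite (tnth_nth 0) /= nth_rcons size_tuple ltnn eqxx. Qed.

Lemma simplex_chart (m : nat) (x : m.-tuple R) :
  simplex (chart x) -> cube 1 x /\ \sum_(i < m) tnth x i < 1.
Proof.
move=> [h _]; split; last first.
  by have /andP[+ _] := h ord_max; rewrite tnth_chart_max subr_gt0.
by move=> i; rewrite -tnth_chart_widen.
Qed.

Lemma suffix_sums_sorted (m : nat) (y : m.-tuple R) :
  (forall i, 0 < tnth y i) -> sorted >%R (suffix_sums y).
Proof.
move=> y0; apply/(sortedP 0) => i; rewrite size_tuple => im.
have im' : (i < m)%N by exact: ltnW.
rewrite -(tnth_nth 0 (suffix_sums y) (Ordinal im)).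
rewrite -(tnth_nth 0 (suffix_sums y) (Ordinal im')) !tnth_mktuple /=.
rewrite [ltRHS](bigD1 (Ordinal im')) //= [X in _ < _ + X](eq_bigl (fun l : 'I_m => (i < l)%N)).
  by rewrite ltrDr.
by move=> l; rewrite -val_eqE /= ltn_neqAle eq_sym andbC.
Qed.

Lemma suffix_sums_cube (m : nat) (y : m.-tuple R) :
  (forall i, 0 < tnth y i) -> \sum_(i < m) tnth y i < 1 ->
  cube 1 (suffix_sums y).
Proof.
move=> y0 y1 i; rewrite tnth_mktuple; apply/andP; split.
  rewrite (bigD1 i) //= ltr_pwDl// sumr_ge0// => l _; exact: ltW.
apply: le_lt_trans y1; rewrite big_mkcond; apply: ler_sum => l _.
by case: ifP => // _; exact: ltW.
Qed.

(** A decreasing tuple is sorted by reversal, so its k-th order statistic is the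
sum of the last k entries of [y], and the successive differences of these sums
are the entries of [y] from the last to the first. *)
Lemma gaps_suffix_sums (m : nat) (y : m.-tuple R) :
  sorted >%R (suffix_sums y) ->
  gaps (suffix_sums y) = chart (tuple_perm (perm (@rev_ord_inj m)) y).
Proof.
move=> sy; pose S (k : nat) : R := \sum_(l < m | (m - k <= l)%N) tnth y l.
(* S k is the k-th order statistic; S 0 = 0 agrees with the convention there. *)
have sE : sort <=%R (suffix_sums y) = rev (suffix_sums y).
  rewrite -[RHS](@sort_le_id _ R); last first.
    by rewrite rev_sorted; apply: sub_sorted sy => a b /= /ltW.
  apply/perm_sortP; [exact: le_total|exact: le_trans|exact: le_anti|].
  by rewrite perm_sym perm_rev.
have osE k : (k <= m)%N -> order_stat (suffix_sums y) k = S k.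
  case: k => [|k] km.
    by rewrite order_stat0 /S big_pred0// => l; rewrite subn0 leqNgt ltn_ord.
  rewrite order_statS// sE nth_rev ?size_tuple//.
  have mk : (m - k.+1 < m)%N by lia.
  by rewrite -[(m - k.+1)%N]/(val (Ordinal mk)) -tnth_nth tnth_mktuple.
apply: eq_from_tnth => i; rewrite tnth_mktuple.
have [im|im] := ltnP i m.
- rewrite !osE//; last exact: ltnW.
  rewrite [RHS](tnth_nth 0) /= nth_rcons size_map size_enum_ord im.
  rewrite -[RHS](tnth_nth 0 (tuple_perm _ y) (Ordinal im)) tnth_mktuple permE.
  rewrite /S [X in X - _](bigD1 (rev_ord (Ordinal im))) /=; last by lia.
  rewrite (eq_bigl (fun l : 'I_m => (m - i <= l)%N)) ?addrK// => l.
  by rewrite -val_eqE /=; lia.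
- have {im}iE : i = m :> nat by apply/eqP; rewrite eqn_leq im -ltnS ltn_ord.
  rewrite iE order_stat_max osE// [RHS](tnth_nth 0) /= nth_rcons size_map.
  rewrite size_enum_ord iE ltnn eqxx /S subnn; congr (_ - _).
  rewrite (reindex_inj (@rev_ord_inj m)) /=.
  by apply: eq_bigr => l _; rewrite tnth_mktuple permE.
Qed.

End gaps_simplex.

(** * Gaps of a uniform sample are uniform on the simplex *)

Section uniform_gaps.
Context {R : realType}.

Lemma measurable_tnth_eq (m : nat) (i j : 'I_m) :
  measurable [set x : m.-tuple R | tnth x i = tnth x j].
Proof.
rewrite (_ : mkset _ = (fun x => tnth x i - tnth x j) @^-1` [set 0]); last first.
  by apply/seteqP; split => x /= => [->|/subr0_eq//]; rewrite subrr.
rewrite -[X in measurable X]setTI.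
have mij : measurable_fun setT (fun x : m.-tuple R => tnth x i - tnth x j).
  by apply: measurable_funB; exact: measurable_tnth.
exact: mij.
Qed.

Lemma measurable_ties (m : nat) : measurable [set x : m.-tuple R | ~~ uniq x].
Proof.
rewrite (_ : mkset _ = \bigcup_(z in [set z : 'I_m * 'I_m | z.1 != z.2])
    [set x : m.-tuple R | tnth x z.1 = tnth x z.2]).
  apply: fin_bigcup_measurable; first exact: finite_finset.
  by move=> z _; exact: measurable_tnth_eq.
apply/seteqP; split => x /=.
- apply: contraNP => h; apply/tuple_uniqP => i j xij.
  by apply/eqP/negPn/negP => ij; apply: h; exists (i, j).
- move=> [[i j] /= ij xij]; apply/negP => /tuple_uniqP/(_ _ _ xij) ijE.
  by rewrite ijE eqxx in ij.
Qed.

(** Once the tail is fixed without ties, the head only has to avoid finitely many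
values. *)
Lemma lebesgue_tuple_ties (m : nat) :
  lebesgue_tuple m [set x : m.-tuple R | ~~ uniq x] = 0%E.
Proof.
elim: m => [|m IH].
  rewrite (_ : mkset _ = set0) ?measure0//.
  by apply/seteqP; split => // x; rewrite /= tuple0.
rewrite [LHS]/= /image_measure /pushforward /product_measure1.
have mN : measurable (@cons_pair R m @^-1` [set x | ~~ uniq x]).
  rewrite -[X in measurable X]setTI; apply: measurable_cons_pair => //.
  exact: measurable_ties.
rewrite (@ge0_negligible_integral _ _ _ (lebesgue_tuple m) _
  [set x : m.-tuple R | ~~ uniq x])//; last 2 first.
- exact: measurable_ties.
- exact: measurable_fun_xsection.
apply: integral0_eq => x [_ /negP/negPn ux] /=.
apply: countable_lebesgue_measure0; apply: finite_set_countable.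
apply: (@sub_finite_set _ _ [set` (x : seq R)]); last exact: finite_seq.
move=> t; rewrite /xsection /= inE /= negb_and => /orP[/negPn//|].
by rewrite ux.
Qed.

Lemma uniform_cube_gaps_notin_simplex (m : nat) :
  uniform_cube m.+1 (@gaps R m.+1 @^-1` (~` @simplex R m.+2)) = 0%E.
Proof.
have mS : measurable (@gaps R m.+1 @^-1` (~` @simplex R m.+2)).
  rewrite -[X in measurable X]setTI; apply: measurable_gaps => //.
  by apply: measurableC; exact: measurable_simplex.
rewrite /uniform_cube /= /mrestr.
rewrite -[LHS]/(lebesgue_tuple m.+1 _).
apply: (@subset_measure0 _ _ _ (lebesgue_tuple m.+1) _ [set x | ~~ uniq x]).
- by apply: measurableI; [exact: mS|exact: measurable_cube].
- exact: measurable_ties.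
- by move=> x [+ x01]; apply: contra_notN => ux; exact/simplex_gapsP/cube_sorted_knots.
- exact: lebesgue_tuple_ties.
Qed.

Definition chamber (m : nat) (s : 'S_m) : set (m.-tuple R) :=
  [set x | sorted >%R (tuple_perm s x)].

Lemma measurable_sorted_gt (m : nat) :
  measurable [set x : m.-tuple R | sorted >%R x].
Proof.
rewrite (_ : mkset _ = \bigcap_(z in [set z : 'I_m * 'I_m | (z.1 < z.2)%N])
    [set x : m.-tuple R | tnth x z.2 < tnth x z.1]).
  apply: fin_bigcap_measurable; first exact: finite_finset.
  move=> z _; rewrite -[X in measurable X]setTI.
  have mz : measurable_fun setT (fun x : m.-tuple R => tnth x z.2 < tnth x z.1).
    by apply: measurable_fun_ltr; exact: measurable_tnth.
  exact: mz.
apply/seteqP; split => x /=.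
- move=> xs [i j] /= ij; rewrite /= !(tnth_nth 0).
  apply: (@sorted_ltn_nth _ >%R) => //; rewrite ?inE ?size_tuple//.
  by move=> ? ? ? /= /[swap]; exact: lt_trans.
- move=> h; apply/(sortedP 0) => i; rewrite size_tuple => im.
  by have /= := h (Ordinal (ltnW im), Ordinal im) (ltnSn i); rewrite !(tnth_nth 0).
Qed.

Lemma tuple_perm_perm_eq (m : nat) (s : 'S_m) (x : m.-tuple R) :
  perm_eq (tuple_perm s x) x.
Proof. by apply/tuple_permP; exists s. Qed.

Lemma chamber_trivIset (m : nat) : trivIset setT (@chamber m).
Proof.
apply/trivIsetP => s t _ _; apply: contraNeq => /set0P[x [/= xs xt]].
have st : tuple_perm s x = tuple_perm t x.
  apply/val_inj/(irr_sorted_eq _ _ xs xt).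
  - by move=> ? ? ? /= /[swap]; exact: lt_trans.
  - by move=> ? /=; exact: ltxx.
  by apply: perm_mem; rewrite (permPl (tuple_perm_perm_eq s x)) perm_sym tuple_perm_perm_eq.
have ux : uniq x.
  rewrite -(perm_uniq (tuple_perm_perm_eq s x)) -rev_uniq.
  by apply: lt_sorted_uniq; rewrite rev_sorted.
apply/eqP/permP => i; apply: (tuple_uniqP x ux).
by have := congr1 (fun y => tnth y i) st; rewrite !tnth_mktuple.
Qed.

Lemma chamber_cover (m : nat) (x : m.-tuple R) :
  uniq x -> exists s, chamber s x.
Proof.
move=> ux; have : perm_eq (rev (sort <=%R x)) x by rewrite perm_rev perm_sort.
move=> /tuple_permP[s sE]; exists s; rewrite /chamber /= -sE.
by rewrite rev_sorted /= sort_lt_sorted.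
Qed.

Lemma measurable_simplex_preimage (m : nat)
    (g : m.+1.-tuple R -> m.+2.-tuple R) (A : set (m.+2.-tuple R)) :
  measurable_fun setT g -> measurable A -> measurable (g @^-1` (A `&` @simplex R m.+2)).
Proof.
move=> mg mA; rewrite -[X in measurable X]setTI; apply: mg => //.
by apply: measurableI => //; exact: measurable_simplex.
Qed.

(** On the decreasing chamber the sample is the suffix sums of the gaps taken
backwards. Reversing the coordinates is harmless, because all of this takes place
inside the cube, whose uniform law is invariant under permutations. *)
Lemma uniform_cube_gaps_chamber (m : nat) (A : set (m.+2.-tuple R)) :
  measurable A ->
  uniform_cube m.+1 ((@gaps R m.+1 @^-1` (A `&` @simplex R m.+2)) `&`
                     [set x | sorted >%R x]) =
  simplex_volume m.+1 A.
Proof.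
move=> mA; set S := @simplex R m.+2; set C : set (m.+1.-tuple R) := [set x | sorted >%R x].
pose r := perm (@rev_ord_inj m.+1).
have mg := measurable_simplex_preimage (@measurable_gaps R m.+1) mA.
have mc := measurable_simplex_preimage (@measurable_chart R m.+1) mA.
have mC : measurable C by exact: measurable_sorted_gt.
rewrite [RHS]/= /mrestr /image_measure /pushforward.
transitivity (uniform_cube m.+1 (@chart R m.+1 @^-1` (A `&` S))); last first.
  by rewrite /= /mrestr setIidl// => x [_] /simplex_chart[].
rewrite -[RHS](uniform_cube_perm r); last exact: mc.
rewrite /uniform_cube /= /mrestr -[LHS]lebesgue_tuple_suffix_sums; last first.
  by apply: measurableI; [exact: measurableI|exact: measurable_cube].
congr (lebesgue_tuple m.+1 _); apply/seteqP; split => y /=.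
- move=> [[+ sy] _]; rewrite gaps_suffix_sums// => -[Ay Sy]; split => // i.
  by have [/(_ (rev_ord i))] := simplex_chart Sy; rewrite tnth_mktuple permE rev_ordK.
- move=> [[Ay Sy] _]; have [yr0 yr1] := simplex_chart Sy.
  have y0 i : 0 < tnth y i.
    by have /andP[+ _] := yr0 (rev_ord i); rewrite tnth_mktuple permE rev_ordK.
  have y1 : \sum_(i < m.+1) tnth y i < 1.
    rewrite (reindex_inj (@perm_inj _ r)) /=; apply: le_lt_trans yr1.
    by apply: ler_sum => i _; rewrite tnth_mktuple.
  have sy := suffix_sums_sorted y0.
  by split; [rewrite gaps_suffix_sums|exact: suffix_sums_cube].
Qed.

(** All chambers contribute equally: gaps do not see the order of the sample, and
permuting coordinates preserves the uniform law. *)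
Lemma uniform_cube_gaps (m : nat) (A : set (m.+2.-tuple R)) :
  measurable A ->
  uniform_cube m.+1 (@gaps R m.+1 @^-1` (A `&` @simplex R m.+2)) =
  ((m.+1)`!%:R%:E * simplex_volume m.+1 A)%E.
Proof.
move=> mA; set E := _ @^-1` _.
have mE : measurable E.
  exact: measurable_simplex_preimage (@measurable_gaps R m.+1) mA.
have mC s : measurable (@chamber m.+1 s).
  rewrite -[X in measurable X]setTI.
  exact: (measurable_tuple_perm s measurableT (@measurable_sorted_gt m.+1)).
have -> : E = \bigcup_(s in [set: 'S_m.+1]) (E `&` chamber s).
  rewrite -setI_bigcupr; apply/esym/setIidl => x [_ /simplex_gapsP/sorted_knots_uniq].
  by move=> /chamber_cover[s xs]; exists s.
rewrite measure_fin_bigcup//; last 3 first.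
- exact: finite_finset.
- by apply: trivIset_setIl; exact: chamber_trivIset.
- by move=> s _; exact: measurableI.
have EsE s : uniform_cube m.+1 (E `&` chamber s) = simplex_volume m.+1 A.
  rewrite -(uniform_cube_gaps_chamber mA) -[RHS](uniform_cube_perm s); last first.
    by apply: measurableI; [exact: mE|exact: measurable_sorted_gt].
  congr (uniform_cube m.+1 _); apply/seteqP; split => x /=;
    by rewrite /E /= (gaps_perm (tuple_perm_perm_eq s x)).
rewrite (eq_fsbigr (fun=> simplex_volume m.+1 A)); last first.
  by move=> s _; exact: EsE.
have -> : [set: 'S_m.+1] = [set` enum {: 'S_m.+1}].
  by apply/seteqP; split => s //= _; rewrite mem_enum.
by rewrite -fsbig_seq ?enum_uniq// big_enum /= sumr_const card_Sn mule_natl.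
Qed.

(** The two sides are proportional, and both have total mass 1. *)
Lemma uniform_simplex_gaps (m : nat) (A : set (m.+2.-tuple R)) :
  measurable A ->
  uniform_simplex m.+1 A = uniform_cube m.+1 (@gaps R m.+1 @^-1` A).
Proof.
move=> mA; rewrite uniform_simplexE.
have gE (B : set (m.+2.-tuple R)) : measurable B ->
    uniform_cube m.+1 (@gaps R m.+1 @^-1` B) = ((m.+1)`!%:R%:E * simplex_volume m.+1 B)%E.
  move=> mB; rewrite -(uniform_cube_gaps mB).
  have -> : @gaps R m.+1 @^-1` B = (@gaps R m.+1 @^-1` (B `&` @simplex R m.+2)) `|`
      ((@gaps R m.+1 @^-1` B) `&` (@gaps R m.+1 @^-1` (~` @simplex R m.+2))).
    by rewrite preimage_setI -setIUr -preimage_setU setUv preimage_setT setIT.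
  have mgB : measurable (@gaps R m.+1 @^-1` B).
    by rewrite -[X in measurable X]setTI; exact: measurable_gaps.
  have mgS : measurable (@gaps R m.+1 @^-1` (~` @simplex R m.+2)).
    rewrite -[X in measurable X]setTI; apply: measurable_gaps => //.
    by apply: measurableC; exact: measurable_simplex.
  apply: measureU0.
  - exact: measurable_simplex_preimage (@measurable_gaps R m.+1) mB.
  - exact: measurableI.
  - apply: (subset_measure0 (measurableI _ _ mgB mgS) mgS) => //.
    exact: uniform_cube_gaps_notin_simplex.
have /andP[v0 voo] := @simplex_volume_gt0_lty R m.
have vfin : simplex_volume m.+1 [set: m.+2.-tuple R] \is a fin_num.
  by rewrite ge0_fin_numE.
have := gE _ measurableT; rewrite preimage_setT uniform_cubeT -(fineK vfin).
move: v0; rewrite -(fineK vfin) lte_fin => v0 [] vE.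
rewrite gE// muleC; congr (_%:E * _)%E.
by apply: (mulIf (lt0r_neq0 v0)); rewrite mulVf ?lt0r_neq0// -vE.
Qed.

End uniform_gaps.

(** * Functions continuous on the unit interval *)

Section clamp.
Context {R : realType}.

Definition clamp (x : R) : R := Num.max 0 (Num.min x 1).

Lemma clamp01 x : 0 <= clamp x <= 1.
Proof. by rewrite /clamp le_max lexx /= ge_max ler01 ge_min lexx orbT. Qed.

Lemma clamp_id x : 0 <= x <= 1 -> clamp x = x.
Proof. by move=> /andP[x0 x1]; rewrite /clamp (min_idPl x1) (max_idPr x0). Qed.

Lemma continuous_clamp : continuous clamp.
Proof.
move=> x.
have cm : {for x, continuous ((id : R -> R^o) \min cst 1)}.
  by apply: continuous_min; [exact: cvg_id|exact: cvg_cst].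
have : {for x, continuous ((cst 0 : R -> R^o) \max (id \min cst 1))}.
  by apply: continuous_max => //; exact: cvg_cst.
exact.
Qed.

Lemma continuous_comp_clamp (f : R -> R) :
  {within `[0, 1], continuous f} -> continuous (f \o clamp).
Proof.
move=> /subspace_continuousP cf x.
apply: (@cvg_comp _ _ _ clamp f _ (within `[0, 1] (nbhs (clamp x)))); last first.
  by apply: cf; rewrite /= in_itv /=; exact: clamp01.
move=> P /= /continuous_clamp cP.
apply: (@filterS _ (nbhs x) _ _ _ _ cP) => z /=; apply.
by rewrite /= in_itv /=; exact: clamp01.
Qed.

(** Uniform continuity, in the form used below: up to [e], variations are
bounded by a multiple of the distance, so that they can be summed over a
subdivision without any control on its mesh. *)
Lemma continuous_le_lipschitz (k : R -> R) (e : R) : continuous k -> 0 < e ->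
  exists2 C : R, 0 <= C &
    forall x y : R, 0 <= x <= 1 -> 0 <= y <= 1 -> k x <= k y + e + C * `|x - y|.
Proof.
move=> ck e0.
have [M M0 kM] : exists2 M : R, 0 < M & forall x : R, 0 <= x <= 1 -> `|k x| <= M.
  have /compact_bounded[M [_ kM]] : compact (k @` `[0, 1]).
    by apply: continuous_compact; [exact: continuous_subspaceT|exact: segment_compact].
  exists (Num.max (M + 1) 1); first by rewrite lt_max ltr01 orbT.
  move=> x x01; apply: kM; first by rewrite lt_max ltrDl ltr01.
  by exists x => //=; rewrite in_itv.
have K : compact `[0:R, 1] by exact: segment_compact.
move/compact_near_coveringP : K => /(_ _ (+oo : set_system R)
  (fun C x : R => 0 <= x <= 1 -> forall y : R, 0 <= y <= 1 -> k x <= k y + e + C * `|x - y|)).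
case.
  move=> x0 _.
  have e2 : 0 < e / 2 by rewrite divr_gt0.
  have [d /= d0 kd] : exists2 d : R, 0 < d & forall y : R, `|x0 - y| < d -> `|k x0 - k y| < e / 2.
    have := ck x0; move/cvgrPdist_lt => /(_ _ e2)[d /= d0 kd]; exists d => //.
  exists (ball x0 (d / 2), [set C | 4 * M / d < C]) => /=.
    split; first by apply: nbhsx_ballx; rewrite divr_gt0.
    by apply: nbhs_pinfty_gt; exact: num_real.
  (* Either y is close to x0, and so k y to k x, or |x - y| >= d / 2 and the term
     C * |x - y| exceeds 2 * M, which bounds the oscillation of k. *)
  move=> [x C] /= [xx0 CM] x01 y y01.
  have C0 : 0 <= C by apply: le_trans (ltW CM); rewrite divr_ge0// ?mulr_ge0// ltW.
  rewrite /ball /= in xx0.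
  have kxx0 : `|k x0 - k x| < e / 2 by apply: kd; lra.
  have [yx0|yx0] := ltP `|x0 - y| d.
    have := kd _ yx0; have : 0 <= C * `|x - y| by rewrite mulr_ge0.
    by move: kxx0; rewrite !ltr_norml => /andP[? ?] ? /andP[? ?]; lra.
  have xy : d / 2 <= `|x - y|.
    have := ler_distD x x0 y; lra.
  have CM2 : 2 * M <= C * `|x - y|.
    rewrite (_ : 2 * M = 4 * M / d * (d / 2)); last by field; rewrite gt_eqF.
    by apply: ler_pM => //; rewrite ?divr_ge0 ?mulr_ge0// ltW.
  move: (kM _ x01) (kM _ y01); rewrite !ler_norml => /andP[? ?] /andP[? ?]; lra.
move=> M' [M'r kM'].
exists (Num.max 0 (M' + 1)); first by rewrite le_max lexx.
move=> x y x01 y01; apply: kM' => //=.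
by rewrite lt_max ltrDl ltr01 orbT.
Qed.

(** Extending the density by constants makes the distribution function
continuously differentiable on a neighbourhood of the unit interval, so that no
one-sided derivatives occur at 0 and 1. *)
Lemma smooth_extension (F f : R -> R) :
  {within `[0, 1], continuous f} ->
  (forall x : R, x \in `[0, 1] ->
      (F x)%:E = (\int[@lebesgue_measure R]_(u in `[0%R, x]) (f u)%:E)%E) ->
  exists Phi : R -> R,
    (forall x : R, x \in `[0, 1] -> Phi x = F x) /\
    (forall x : R, -1 < x -> is_derive x 1 Phi (f (clamp x))).
Proof.
move=> cf Ff; pose phi := f \o clamp.
have cphi : continuous phi by exact: continuous_comp_clamp.
have iphi a b : (@lebesgue_measure R).-integrable `[a, b] (EFin \o phi).
  apply: continuous_compact_integrable; first exact: segment_compact.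
  exact: continuous_subspaceT.
pose P (x : R) : R := (\int[@lebesgue_measure R]_(t in `[(-1), x]) phi t)%R.
exists (fun x => P x - P 0); split.
- move=> x; rewrite in_itv /= => /andP[x0 x1].
  have fphi : {in `[0, x], f =1 phi}.
    move=> u; rewrite in_itv /= => /andP[u0 ux].
    by rewrite /phi /= clamp_id// u0 (le_trans ux).
  apply: EFin_inj; rewrite Ff ?in_itv /= ?x0//.
  rewrite /P Rintegral_itvB ?bnd_simp ?lerN10//.
  rewrite Rintegral_itv_obnd_cbnd; last first.
    by apply: integrableS (iphi 0 x) => //; exact: subset_itv_oc_cc.
  rewrite /Rintegral fineK; last exact: integrable_fin_num.
  by apply: eq_integral => u /set_mem /fphi ->.
- move=> x x1.
  have [dP PE] := @continuous_FTC1_closed R phi (-1) x (x + 1) ltac:(lra) (iphi _ _) x1 (cphi x).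
  have dP' : is_derive x 1 P (phi x).
    by rewrite -PE derive1E; exact: derivableP.
  by rewrite -[f (clamp x)]subr0; apply: is_deriveB.
Qed.

End clamp.

(** * The probability integral transform *)

Section probability_integral_transform.
Context {R : realType}.
Variables Phi phi : R -> R.
Hypothesis cphi : continuous phi.
Hypothesis phi_gt0 : forall x, 0 < phi x.
Hypothesis dPhi : forall x : R, -1 < x -> is_derive x 1 Phi (phi x).
Hypothesis Phi0 : Phi 0 = 0.
Hypothesis Phi1 : Phi 1 = 1.

Let derivable_Phi (x : R) : -1 < x -> derivable Phi x 1.
Proof. by move=> /dPhi[]. Qed.

Let continuous_Phi (x : R) : -1 < x -> {for x, continuous Phi}.
Proof.
by move=> x1; apply/differentiable_continuous/derivable1_diffP/derivable_Phi.
Qed.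

Lemma within_continuous_Phi : {within `[0, 1], continuous Phi}.
Proof.
apply: derivable_within_continuous => x; rewrite in_itv /= => /andP[x0 _].
by apply: derivable_Phi; apply: lt_le_trans x0; rewrite ltrN10.
Qed.

Lemma cdf_MVT (x y : R) : 0 <= x -> x <= y ->
  exists2 c, x <= c <= y & Phi y - Phi x = phi c * (y - x).
Proof.
move=> x0 xy.
have [||c cxy ->] := @MVT_segment R Phi phi x y xy.
- move=> z; rewrite in_itv /= => /andP[xz _]; apply: dPhi.
  by apply: lt_trans xz; apply: lt_le_trans x0; rewrite ltrN10.
- apply: derivable_within_continuous => z; rewrite in_itv /= => /andP[xz _].
  by apply: derivable_Phi; apply: lt_le_trans xz; apply: lt_le_trans x0; rewrite ltrN10.
by exists c; rewrite // -in_itv.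
Qed.

Lemma cdf_lt (x y : R) : 0 <= x -> x < y -> Phi x < Phi y.
Proof.
move=> x0 xy; have [c _ E] := cdf_MVT x0 (ltW xy).
by rewrite -subr_gt0 E mulr_gt0// subr_gt0.
Qed.

Lemma cdf_le (x y : R) : 0 <= x -> 0 <= y -> (Phi x <= Phi y) = (x <= y).
Proof.
move=> x0 y0; apply/idP/idP => [|]; last first.
  by rewrite le_eqVlt => /predU1P[->//|xy]; exact/ltW/cdf_lt.
by apply: contraTT; rewrite -!ltNge; exact: cdf_lt.
Qed.

Definition quantile (t : R) : R := xget 0 [set x | 0 <= x <= 1 /\ Phi x = t].

Lemma quantileP (t : R) : 0 <= t <= 1 ->
  0 <= quantile t <= 1 /\ Phi (quantile t) = t.
Proof.
move=> t01; have [|c c01 ct] := IVT (@ler01 R) within_continuous_Phi (v := t).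
  by rewrite Phi0 Phi1 (min_idPl ler01) (max_idPr ler01).
apply: (@xgetPex _ 0 [set x | 0 <= x <= 1 /\ Phi x = t]).
by exists c; split => //; rewrite -in_itv.
Qed.

Lemma cdf01 (x : R) : 0 <= x <= 1 -> 0 <= Phi x <= 1.
Proof. by move=> /andP[x0 x1]; rewrite -{1}Phi0 -Phi1 !cdf_le// x0. Qed.

Lemma cdfK : {in `[0, 1], cancel Phi quantile}.
Proof.
move=> x; rewrite in_itv /= => x01.
have [/andP[q0 _] qE] := quantileP (cdf01 x01).
have /andP[x0 _] := x01.
by apply/eqP; rewrite eq_le -(cdf_le q0 x0) -(cdf_le x0 q0) qE lexx.
Qed.

Lemma within_continuous_quantile : {within `[0, 1], continuous quantile}.
Proof.
have := segment_can_le_continuous (@ler01 R) within_continuous_Phi cdfK.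
by rewrite Phi0 Phi1.
Qed.

(** [Phi] stands for the distribution function on the unit interval only. *)
Definition cdf_clamp : R -> R := Phi \o clamp.

Lemma continuous_cdf_clamp : continuous cdf_clamp.
Proof. exact/continuous_comp_clamp/within_continuous_Phi. Qed.

Lemma cdf_clamp01 (x : R) : 0 <= cdf_clamp x <= 1.
Proof. exact/cdf01/clamp01. Qed.

Lemma cdf_clamp_le (x t : R) : 0 <= t < 1 -> (cdf_clamp x <= t) = (x <= quantile t).
Proof.
move=> /andP[t0 t1]; have [|/andP[q0 _] qE] := @quantileP t; first by rewrite t0 ltW.
have q1 : quantile t < 1.
  by rewrite ltNge -cdf_le// qE Phi1 -ltNge.
have /andP[c0 _] := clamp01 x.
rewrite /cdf_clamp /= -{1}qE cdf_le// /clamp ge_max q0 /= ge_min.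
by rewrite [1 <= _]leNgt q1 orbF.
Qed.

Section law.
Context d (T : measurableType d) (Pr : probability T R) (X : {RV Pr >-> R}).
Hypothesis cdfX : forall x, x \in `[0, 1] -> cdf X x = (Phi x)%:E.

Definition uniformized (w : T) : measurableTypeR R := cdf_clamp (X w).

Lemma measurable_uniformized : measurable_fun setT uniformized.
Proof.
have : measurable_fun setT (cdf_clamp \o X).
  apply: measurableT_comp => //; apply: continuous_measurable_fun.
  exact: continuous_cdf_clamp.
exact.
Qed.

HB.instance Definition _ :=
  isMeasurableFun.Build _ _ _ _ uniformized measurable_uniformized.

(** Both sides are measures, so it is enough to compare them on the rays
[`]t, +oo[], whose preimages are rays that start at a quantile. *)
Lemma uniformized_law (B : set (measurableTypeR R)) : measurable B ->
  Pr (uniformized @^-1` B) = lebesgue_measure (B `&` `]0%R, 1%R[).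
Proof.
move=> mB.
have mI : measurable (`]0%R, 1%R[%classic : set (measurableTypeR R)).
  exact: measurable_itv.
pose mu1 := [the {measure set (measurableTypeR R) -> \bar R} of
  image_measure Pr [the {mfun _ >-> _} of uniformized]].
pose mu2 := [the {measure set (measurableTypeR R) -> \bar R} of
  mrestr lebesgue_measure mI].
apply: (@measure_unique _ _ (measurableTypeR R) (@RGenOInfty.G R)
  (fun n => `](- n%:R), +oo[%classic) _ _ _ _ mu1 mu2) => //.
- exact: RGenOInfty.measurableE.
- move=> _ _ [a ->] [b ->]; exists (Num.max a b).
  apply/seteqP; split => x /=; rewrite !in_itv /= !andbT gt_max.
    by move=> [-> ->].
  by move=> /andP[].
- by move=> n; exists (- n%:R).
- apply/seteqP; split => // x _; exists (Num.bound `|x|) => //=.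
  rewrite in_itv /= andbT ltrNl; have := archi_boundP (normr_ge0 x).
  by apply: le_lt_trans; rewrite -normrN ler_norm.
- move=> _ [t ->]; rewrite /= /image_measure /pushforward /mrestr.
  have [t0|t0] := ltP t 0.
    rewrite (_ : _ @^-1` _ = setT).
      rewrite probability_setT (_ : _ `&` _ = `]0%R, 1%R[%classic).
        by rewrite lebesgue_measure_itv /= lte_fin ltr01 sube0.
      apply/seteqP; split => x /=; first by move=> [].
      by rewrite !in_itv /= => /[dup] x01 /andP[x0 _]; rewrite (lt_trans t0).
    apply/seteqP; split => // w _ /=; rewrite in_itv /= andbT.
    by have /andP[+ _] := cdf_clamp01 (X w); exact: lt_le_trans.
  have [t1|t1] := leP 1 t.
    rewrite (_ : _ @^-1` _ = set0); last first.
      apply/seteqP; split => // w /=; rewrite in_itv /= andbT.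
      by have /andP[_ +] := cdf_clamp01 (X w) => /[swap] /lt_le_trans/[apply]; rewrite ltNge t1.
    rewrite (_ : _ `&` _ = set0) ?measure0//.
    apply/seteqP; split => // x /=; rewrite !in_itv /= andbT => -[tx /andP[_ x1]].
    by have := lt_trans tx x1; rewrite ltNge t1.
  rewrite (_ : _ @^-1` _ = ~` (X @^-1` `]-oo, quantile t])); last first.
    apply/seteqP; split => w /=; rewrite !in_itv /= andbT -cdf_clamp_le ?t0//.
      by rewrite leNgt => ->.
    by move/negP; rewrite -ltNge.
  have [|q01 qE] := @quantileP t; first by rewrite t0 ltW.
  rewrite probability_setC; last first.
    by rewrite -[X in measurable X]setTI; exact: measurable_funPT.
  have := cdfX (x := quantile t); rewrite in_itv => /(_ q01).
  rewrite /cdf /distribution /pushforward qE => ->.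
  rewrite (_ : _ `&` _ = `]t, 1%R[%classic).
    by rewrite lebesgue_measure_itv /= lte_fin t1.
  apply/seteqP; split => x /=; rewrite !in_itv /= andbT.
    by move=> [-> /andP[_ ->]].
  by move=> /andP[tx ->]; rewrite tx (le_lt_trans t0).
- move=> n; apply: le_lt_trans (ltry 1).
  apply: (@probability_le1 _ _ _ Pr).
  by rewrite -[X in measurable X]setTI; exact: measurable_uniformized.
Qed.

(** Writing [k] as [k \o quantile] after the distribution function reduces the
expectation to an integral against the uniform law, and the substitution
[t = Phi x] brings the density back. *)
Lemma expectation_density (k : R -> R) : continuous k ->
  (forall x, 0 <= k x) -> (forall x, k (clamp x) = k x) ->
  (\int[Pr]_w (k (X w))%:E =
   \int[@lebesgue_measure R]_(x in `[0%R, 1%R]) (k x * phi x)%:E)%E.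
Proof.
move=> ck k0 kclamp; pose h := k \o (quantile \o clamp).
have ch : continuous h.
  move=> x; apply: continuous_comp; last exact: ck.
  exact: (continuous_comp_clamp within_continuous_quantile).
have hE x : h (cdf_clamp x) = k x.
  rewrite /h /= (clamp_id (cdf_clamp01 x)) /cdf_clamp /= cdfK ?kclamp//.
  by rewrite in_itv /= clamp01.
have mh : measurable_fun setT (EFin \o h : measurableTypeR R -> \bar R).
  by have /measurable_EFinP := continuous_measurable_fun ch.
pose nu := [the {measure set (measurableTypeR R) -> \bar R} of
  image_measure Pr [the {mfun _ >-> _} of uniformized]].
have mI : measurable (`]0%R, 1%R[%classic : set (measurableTypeR R)).
  exact: measurable_itv.
have nuI A : measurable A -> nu A = lebesgue_measure (A `&` `]0%R, 1%R[).
  exact: uniformized_law.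
transitivity (\int[nu]_(t in setT) (h t)%:E)%E.
  rewrite (@ge0_integral_pushforward _ _ _ _ R _ measurable_uniformized)//.
    by apply: eq_integral => w _ /=; rewrite /uniformized hE.
  by move=> t _; rewrite lee_fin; exact: k0.
transitivity (\int[nu]_(t in `]0%R, 1%R[) (h t)%:E)%E.
  rewrite (@ge0_negligible_integral _ _ _ nu setT (~` `]0%R, 1%R[))//.
  - by rewrite setTD setCK.
  - exact: measurableC.
  - by move=> t _; rewrite lee_fin; exact: k0.
  - by rewrite nuI ?setICl ?measure0//; exact: measurableC.
transitivity (\int[lebesgue_measure]_(t in `]0%R, 1%R[) (h t)%:E)%E.
  apply: eq_measure_integral => A mA AI.
  by rewrite -[LHS]/(nu A) nuI// setIidl.
rewrite -(@integral_itv_bndoo _ _ _ _ true false); last first.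
  by apply/measurable_funTS/measurable_EFinP; exact: continuous_measurable_fun.
have PhiE := @integration_by_substitution_increasing R Phi h 0 1 ler01.
have dE (x : R) : -1 < x -> Phi^`()%classic x = phi x.
  by move=> x1; rewrite derive1E; have dx := dPhi x1; rewrite derive_val.
have cdPhi (x : R) : -1 < x -> {for x, continuous Phi^`()%classic}.
  move=> x1; rewrite /prop_for /continuous_at (dE x x1).
  have phix : phi y @[y --> x] --> phi x by exact: cphi.
  apply: cvg_trans phix; apply: near_eq_cvg.
  by near=> y; rewrite dE//; near: y; exact: lt_nbhsr.
rewrite Phi0 Phi1 in PhiE; rewrite PhiE.
- apply: eq_integral => x /set_mem; rewrite /= in_itv /= => x01; congr (_%:E).
  rewrite fctE dE; last by case/andP: x01 => + _; apply: lt_le_trans; rewrite ltrN10.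
  by congr (_ * _); rewrite -(hE x) /cdf_clamp /= clamp_id.
- by move=> x y; rewrite !in_itv /= => /andP[x0 _] _; exact: cdf_lt.
- move=> x; rewrite in_itv /= => /andP[x0 _]; apply: cdPhi.
  by apply: lt_trans x0; rewrite ltrN10.
- apply/cvg_ex; exists (Phi^`()%classic 0); apply: cvg_at_right_filter.
  by apply: cdPhi; rewrite ltrN10.
- apply/cvg_ex; exists (Phi^`()%classic 1); apply: cvg_at_left_filter.
  by apply: cdPhi; rewrite (lt_trans _ ltr01)// ltrN10.
- split.
  + move=> x; rewrite in_itv /= => /andP[x0 _]; apply: derivable_Phi.
    by apply: lt_trans x0; rewrite ltrN10.
  + by apply/cvg_at_right_filter/continuous_Phi; rewrite ltrN10.
  + by apply/cvg_at_left_filter/continuous_Phi; rewrite (lt_trans _ ltr01)// ltrN10.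
- exact: continuous_subspaceT.
Unshelve. all: by end_near. Qed.

End law.

End probability_integral_transform.

(** * The cost of the monotone coupling *)

Section cost_bounds.
Context {R : realType}.

Lemma ln_le_subr1 (x : R) : 0 < x -> ln x <= x - 1.
Proof.
move=> x0; have := @le_ln1Dx R (x - 1).
by rewrite (addrC 1) subrK; apply; rewrite ltrBrDl subrr.
Qed.

(** Jensen's inequality for the logarithm, by summing the bounds
[ln (r / A) <= r / A - 1] where [A] is the mean of the ratios [r]. *)
Lemma cost_ge0 (n : nat) (p q : n.+1.-tuple R) :
  (forall i, 0 < tnth p i) -> (forall i, 0 < tnth q i) -> 0 <= cost p q.
Proof.
move=> p0 q0; rewrite /cost subr_ge0.
pose r i := tnth q i / tnth p i.
have r0 i : 0 < r i by rewrite divr_gt0.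
set A := (_ * _ in leRHS).
have S0 : 0 < \sum_(i < n.+1) r i.
  by rewrite big_ord_recl ltr_pwDl// sumr_ge0// => i _; exact: ltW.
have A0 : 0 < A by rewrite mulr_gt0// invr_gt0 ltr0n.
have rA i : ln (r i) <= ln A + (r i / A - 1).
  by rewrite -lerBlDl -ln_div ?posrE//; apply: ln_le_subr1; rewrite divr_gt0.
rewrite mulrC ler_pdivrMr ?ltr0n//; apply: le_trans (ler_sum _ (fun i _ => rA i)) _.
rewrite big_split /= sumr_const card_ord sumrB -mulr_suml sumr_const card_ord.
rewrite (_ : _ / A = n.+1%:R); last first.
  rewrite /A -/(\sum_(i < n.+1) r i); field.
  by rewrite nat1r pnatr_eq0 /= gt_eqF.
by rewrite subrr addr0 mulr_natr.
Qed.

(** Only the logarithm of the mean is estimated, by [ln A <= A - 1]; what remains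
is a mean over the coordinates. *)
Lemma cost_le (n : nat) (p q : n.+1.-tuple R) :
  (forall i, 0 < tnth p i) -> (forall i, 0 < tnth q i) ->
  cost p q <= n.+1%:R^-1 *
    \sum_(i < n.+1) ((tnth p i / tnth q i)^-1 - 1 + ln (tnth p i / tnth q i)).
Proof.
move=> p0 q0; rewrite /cost.
pose r i := tnth q i / tnth p i.
have r0 i : 0 < r i by rewrite divr_gt0.
have S0 : 0 < \sum_(i < n.+1) r i.
  by rewrite big_ord_recl ltr_pwDl// sumr_ge0// => i _; exact: ltW.
apply: (@le_trans _ _ (n.+1%:R^-1 * (\sum_(i < n.+1) r i) - 1
    - n.+1%:R^-1 * (\sum_(i < n.+1) ln (r i)))).
  by rewrite lerD2r; apply: ln_le_subr1; rewrite mulr_gt0// invr_gt0 ltr0n.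
rewrite [X in _ <= _ * X](eq_bigr (fun i => r i - 1 - ln (r i))); last first.
  move=> i _; have -> : tnth p i / tnth q i = (r i)^-1 by rewrite invf_div.
  by rewrite invrK lnV ?posrE.
by rewrite !sumrB sumr_const card_ord !mulrBr mulVf.
Qed.

End cost_bounds.

Section monotone_coupling.
Context {R : realType}.
Variables Phi phi : R -> R.
Hypothesis cphi : continuous phi.
Hypothesis phi_gt0 : forall x, 0 < phi x.
Hypothesis dPhi : forall x : R, -1 < x -> is_derive x 1 Phi (phi x).
Hypothesis Phi0 : Phi 0 = 0.
Hypothesis Phi1 : Phi 1 = 1.

Let G := cdf_clamp Phi.

Let G_nd : {homo G : x y / x <= y}.
Proof.
move=> x y xy; rewrite /G /cdf_clamp /= (cdf_le phi_gt0 dPhi); last 2 first.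
  by have /andP[] := clamp01 x.
  by have /andP[] := clamp01 y.
by rewrite /clamp ge_max !le_max lexx /= le_min !ge_min xy lexx !orbT.
Qed.

Let G0 : G 0 = 0.
Proof. by rewrite /G /cdf_clamp /= clamp_id ?lexx ?ler01. Qed.

Let G1 : G 1 = 1.
Proof. by rewrite /G /cdf_clamp /= clamp_id ?lexx ?ler01. Qed.

Definition uniformized_tuple (m : nat) (x : m.-tuple R) : m.-tuple R :=
  map_tuple (cdf_clamp Phi) x.

Lemma order_stat_uniformized (m : nat) (x : m.-tuple R) (k : nat) :
  (k <= m.+1)%N -> order_stat (uniformized_tuple x) k = G (order_stat x k).
Proof.
have sortE : sort <=%R (uniformized_tuple x) = map G (sort <=%R x).
  rewrite -[RHS](@sort_le_id _ R); last first.
    by apply: (homo_sorted G_nd); exact: sort_le_sorted.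
  apply/perm_sortP; [exact: le_total|exact: le_trans|exact: le_anti|].
  by rewrite perm_map// perm_sym perm_sort.
case: k => [_|k]; first by rewrite !order_stat0 G0.
rewrite ltnS leq_eqVlt => /predU1P[->|km]; first by rewrite !order_stat_max G1.
by rewrite !order_statS// sortE (nth_map 0)// size_sort size_tuple.
Qed.

(** The summand of [cost_le] for a ratio of gaps equal to [phi u]. Its integral
against a probability density [phi] is that of [phi * ln phi]. *)
Definition excess (u : R) : R := (phi u)^-1 - 1 + ln (phi u).

Lemma excess_ge0 (u : R) : 0 <= excess u.
Proof.
have := @ln_le_subr1 R (phi u)^-1; rewrite invr_gt0 => /(_ (phi_gt0 u)).
by rewrite lnV ?posrE// -subr_ge0 opprK.
Qed.

Lemma continuous_excess : continuous excess.
Proof.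
move=> x; rewrite /excess; apply: cvgD.
  by apply: cvgB; [apply: cvgV; [rewrite gt_eqF|exact: cphi]|exact: cvg_cst].
by apply: continuous_comp; [exact: cphi|exact: continuous_ln].
Qed.

Lemma order_stat01 (m : nat) (x : m.-tuple R) (k : nat) :
  sorted <%R (knots x) -> (k <= m.+1)%N -> 0 <= order_stat x k <= 1.
Proof.
rewrite lt_sorted_uniq_le => /andP[_ sx] km.
have mono := sorted_leq_nth le_trans le_refl 0 sx.
by rewrite -{1}(order_stat0 x) -(order_stat_max x) !mono// inE size_knots.
Qed.

(** The ratio of the two gaps over a cell is a value of [phi] in that cell, by
the mean value theorem; moving it to the right end of the cell costs a multiple
of the length of the cell, and the lengths add up to 1. *)
Lemma cost_monotone_coupling (e C : R) (m : nat) (x : m.+1.-tuple R) :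
  (forall u v : R, 0 <= u <= 1 -> 0 <= v <= 1 ->
     excess u <= excess v + e + C * `|u - v|) -> 0 <= C ->
  simplex (gaps x) -> simplex (gaps (uniformized_tuple x)) ->
  cost (gaps (uniformized_tuple x)) (gaps x) <=
  m.+2%:R^-1 * (\sum_(i < m.+1) excess (tnth x i) + excess 1 + C) + e.
Proof.
move=> excessC C0 Sx Su.
have sx : sorted <%R (knots x) by exact/simplex_gapsP.
have [p0 _] := (simplexP _).1 Su; have [q0 _] := (simplexP _).1 Sx.
apply: (le_trans (cost_le p0 q0)).
have cell (i : 'I_m.+2) : (tnth (gaps (uniformized_tuple x)) i / tnth (gaps x) i)^-1
    - 1 + ln (tnth (gaps (uniformized_tuple x)) i / tnth (gaps x) i) <=
    excess (order_stat x i.+1) + e + C * tnth (gaps x) i.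
  have i1 : (i < m.+2)%N by [].
  have s01 := order_stat01 sx (ltnW i1); have t01 := order_stat01 sx i1.
  have := q0 i; rewrite !tnth_mktuple => st.
  rewrite !order_stat_uniformized ?(ltnW i1)// /G /cdf_clamp /= !clamp_id//.
  have /andP[s0 _] := s01; have st' : order_stat x i <= order_stat x i.+1.
    by rewrite -subr_ge0 ltW.
  have [c /andP[sc ct] ->] := cdf_MVT dPhi s0 st'.
  rewrite mulfK ?gt_eqF//; apply: (le_trans (excessC c (order_stat x i.+1) _ _)) => //.
    by rewrite (le_trans s0)//= (le_trans ct)//; case/andP: t01.
  rewrite lerD2l ler_wpM2l// distrC ger0_norm ?subr_ge0//.
  by rewrite lerD2l lerN2.
apply: (@le_trans _ _ (m.+2%:R^-1 * (\sum_(i < m.+2)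
   (excess (order_stat x i.+1) + e + C * tnth (gaps x) i)))).
  by rewrite ler_pM2l ?invr_gt0 ?ltr0n//; apply: ler_sum => i _; exact: cell.
rewrite 2!big_split /= -mulr_sumr sum_gaps sumr_const card_ord.
have -> : \sum_(i < m.+2) excess (order_stat x i.+1) =
    \sum_(i < m.+1) excess (tnth x i) + excess 1.
  rewrite big_ord_recr /= order_stat_max; congr (_ + _).
  rewrite -(big_tuple _ _ x xpredT excess) -(perm_big _ (permEl (perm_sort <=%R x))).
  rewrite [RHS](big_nth 0) size_sort size_tuple big_mkord.
  by apply: eq_bigr => i _; rewrite order_statS.
by rewrite mulr1 addrAC mulrDr -[e *+ _]mulr_natl mulKf// pnatr_eq0.
Qed.

End monotone_coupling.

(** * The monotone coupling of the two laws *)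

(** Where all entries are positive, ratios are exponentials of differences of
logarithms, which reduces the measurability of the cost to that of [expR] and
[ln]. *)
Lemma measurable_cost (R : realType) (n : nat) :
  measurable_fun (@simplex R n `*` @simplex R n)
    (fun z : n.-tuple R * n.-tuple R => cost z.1 z.2).
Proof.
pose r (z : n.-tuple R * n.-tuple R) i := expR (ln (tnth z.2 i) - ln (tnth z.1 i)).
have mr i : measurable_fun setT (r ^~ i).
  apply: measurableT_comp => //; apply: measurable_funB; apply: measurableT_comp => //.
    exact: (measurableT_comp (measurable_tnth i) measurable_snd).
  exact: (measurableT_comp (measurable_tnth i) measurable_fst).
apply: (@eq_measurable_fun _ _ _ _ _ (fun z =>
  ln (n%:R^-1 * \sum_(i < n) r z i) - n%:R^-1 * \sum_(i < n) ln (r z i))).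
  move=> z /set_mem [] /= [p0 _] [q0 _].
  have rE i : r z i = tnth z.2 i / tnth z.1 i.
    have /andP[pi0 _] := p0 i; have /andP[qi0 _] := q0 i.
    by rewrite /r -ln_div ?posrE// lnK// posrE divr_gt0.
  by rewrite /cost; congr (ln (_ * _) - _ * _); apply: eq_bigr => i _; rewrite rE.
apply: measurable_funTS; apply: measurable_funB.
  apply: measurableT_comp => //; apply: measurable_funM => //.
  by apply: measurable_sum => i; exact: mr.
apply: measurable_funM => //; apply: measurable_sum => i.
by apply: measurableT_comp => //; exact: mr.
Qed.

Section coupling.
Context {R : realType}.
Variables Phi phi : R -> R.
Hypothesis cphi : continuous phi.
Hypothesis phi_gt0 : forall x, 0 < phi x.
Hypothesis phi_clamp : forall x, phi (clamp x) = phi x.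
Hypothesis dPhi : forall x : R, -1 < x -> is_derive x 1 Phi (phi x).
Hypothesis Phi0 : Phi 0 = 0.
Hypothesis Phi1 : Phi 1 = 1.
Context d (T : measurableType d) (Pr : probability T R) (m : nat)
  (X : 'I_m.+1 -> {RV Pr >-> R}).
Hypothesis X_iid : iid_with_cdf01 X Phi.

Let U (w : T) : m.+1.-tuple R := uniformized_tuple Phi (sample X w).

Let measurable_U : measurable_fun setT U.
Proof.
apply/measurable_fun_tnthP => i.
rewrite (_ : _ \o _ = cdf_clamp Phi \o X i); last first.
  by apply/funext => w /=; rewrite tnth_map tnth_mktuple.
apply: measurableT_comp => //; apply: continuous_measurable_fun.
exact: (continuous_cdf_clamp dPhi).
Qed.

HB.instance Definition _ := isMeasurableFun.Build _ _ _ _ U measurable_U.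

(** Boxes determine the law, and on a box independence reduces the claim to the
probability integral transform of each coordinate. *)
Lemma sample_uniformized_law (A : set (m.+1.-tuple R)) : measurable A ->
  Pr (U @^-1` A) = uniform_cube m.+1 A.
Proof.
move=> mA.
apply: (@measure_box_unique R m.+1
  [the {measure set _ -> \bar R} of image_measure Pr [the {mfun _ >-> _} of U]]
  (uniform_cube m.+1)) => //.
  by rewrite /= /image_measure /pushforward preimage_setT probability_setT ltry.
move=> B mB; rewrite uniform_cube_box//= /image_measure /pushforward.
have mG i : measurable (cdf_clamp Phi @^-1` B i).
  rewrite -[X in measurable X]setTI.
  exact: (continuous_measurable_fun (continuous_cdf_clamp dPhi)).
have [ind cdfX] := X_iid.
have := ind [set: 'I_m.+1]%SET _ mG.
rewrite (_ : \bigcap_(i in _) _ = U @^-1` box B).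
  move=> ->; rewrite [LHS](eq_bigl xpredT); last by move=> i; rewrite finset.in_setT.
  apply: eq_bigr => i _.
  exact: (uniformized_law phi_gt0 dPhi Phi0 Phi1 (cdfX i) (mB i)).
apply/seteqP; split => w /= h i; have := h i.
  by rewrite tnth_map tnth_mktuple; apply; exact: finset.in_setT.
by rewrite tnth_map tnth_mktuple.
Qed.

Definition monotone_pair (w : T) : m.+2.-tuple R * m.+2.-tuple R :=
  (gaps (U w), gaps (sample X w)).

Lemma measurable_monotone_pair : measurable_fun setT monotone_pair.
Proof.
apply: measurable_fun_pair; apply: measurableT_comp => //.
Qed.

HB.instance Definition _ :=
  isMeasurableFun.Build _ _ _ _ monotone_pair measurable_monotone_pair.

Definition monotone_coupling : probability (m.+2.-tuple R * m.+2.-tuple R)%type R :=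
  [the probability _ R of distribution Pr [the {mfun _ >-> _} of monotone_pair]].

Lemma monotone_coupling_couples :
  couplings (uniform_simplex m.+1) (gap_law X) monotone_coupling.
Proof.
split => // A mA; rewrite uniform_simplex_gaps// -sample_uniformized_law//.
by rewrite -[X in measurable X]setTI; exact: measurable_gaps.
Qed.

(** The bound on the cost, being nonnegative, may be integrated over the whole
sample space instead of the event that both gap vectors lie on the simplex. *)
Lemma transport_cost_le (e C J : R) :
  0 <= e -> 0 <= C ->
  (forall u v : R, 0 <= u <= 1 -> 0 <= v <= 1 ->
     excess phi u <= excess phi v + e + C * `|u - v|) ->
  (\int[@lebesgue_measure R]_(x in `[0%R, 1%R]) (excess phi x * phi x)%:E = J%:E)%E ->
  (transport_cost (uniform_simplex m.+1) (gap_law X) <=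
   (J + (excess phi 1 + C) / m.+2%:R + e)%:E)%E.
Proof.
move=> e0 C0 excessC JE.
pose S2 := @simplex R m.+2 `*` @simplex R m.+2.
have mS2 : measurable S2 by apply: measurableX; exact: measurable_simplex.
have excess0 := excess_ge0 phi_gt0.
have mexcess i : measurable_fun setT (fun w => excess phi (X i w)).
  apply: (@measurableT_comp _ _ _ _ _ _ (excess phi)) => //.
  by apply: continuous_measurable_fun; exact: continuous_excess.
pose K := excess phi 1 + C.
have K0 : 0 <= K by rewrite addr_ge0.
pose b w := m.+2%:R^-1 * (\sum_(i < m.+1) excess phi (X i w)) + (K / m.+2%:R + e).
have c0 : 0 <= K / m.+2%:R + e by rewrite addr_ge0// divr_ge0.
have b0 w : 0 <= b w.
  by rewrite addr_ge0// mulr_ge0 ?invr_ge0// sumr_ge0.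
have mb : measurable_fun setT b.
  apply: measurable_funD => //; apply: measurable_funM => //.
  by apply: measurable_sum => i; exact: mexcess.
have cost0 z : S2 z -> (0 <= (cost z.1 z.2)%:E)%E.
  move=> [/simplexP[p0 _] /simplexP[q0 _]]; rewrite lee_fin; exact: cost_ge0.
apply: (@le_trans _ _ (\int[monotone_coupling]_(z in S2) (cost z.1 z.2)%:E)%E).
  by apply: ereal_inf_lbound; exists monotone_coupling => //; exact: monotone_coupling_couples.
rewrite (@ge0_integral_pushforward _ _ _ _ R _ measurable_monotone_pair)//; last 2 first.
- by apply/measurable_EFinP; exact: measurable_cost.
- by move=> z /set_mem; exact: cost0.
have mD : measurable (monotone_pair @^-1` S2).
  by rewrite -[X in measurable X]setTI; exact: measurable_monotone_pair.
apply: (@le_trans _ _ (\int[Pr]_(w in monotone_pair @^-1` S2) (b w)%:E)%E).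
  apply: ge0_le_integral => //.
  - by move=> w Dw; exact: (cost0 (monotone_pair w)).
  - have DS2 : monotone_pair @` (monotone_pair @^-1` S2) `<=` S2 by move=> _ [w Dw <-].
    apply: (measurable_comp mS2 DS2).
    + by apply/measurable_EFinP; exact: measurable_cost.
    + by apply: measurable_funTS; exact: measurable_monotone_pair.
  - by apply/measurable_EFinP; exact: measurable_funTS.
  - move=> w [Sp Sq]; rewrite lee_fin.
    apply: (le_trans (cost_monotone_coupling phi_gt0 dPhi Phi0 Phi1 excessC C0 Sq Sp)).
    under eq_bigr do rewrite tnth_mktuple.
    by rewrite /b /K -[_ + _ + C]addrA mulrDr -addrA [(_ + C) / _]mulrC.
apply: (@le_trans _ _ (\int[Pr]_w (b w)%:E)%E).
  apply: ge0_subset_integral => //; first exact/measurable_EFinP.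
  by move=> w _; rewrite lee_fin.
have EX i : (\int[Pr]_w (excess phi (X i w))%:E = J%:E)%E.
  have [_ cdfX] := X_iid; rewrite -JE.
  apply: (expectation_density cphi phi_gt0 dPhi Phi0 Phi1 (cdfX i)) => //.
    exact: continuous_excess.
  by move=> x; rewrite /excess phi_clamp.
rewrite (eq_integral (fun w => (m.+2%:R^-1)%:E * (\sum_(i < m.+1) (excess phi (X i w))%:E)
   + (K / m.+2%:R + e)%:E)%E); last first.
  by move=> w _; rewrite /b EFinD EFinM sumEFin.
have mEX i : measurable_fun setT (fun w => (excess phi (X i w))%:E).
  exact/measurable_EFinP.
have sE0 w : (0 <= \sum_(i < m.+1) (excess phi (X i w))%:E)%E.
  by apply: sume_ge0 => i _; rewrite lee_fin.
have msE : measurable_fun setT (fun w => \sum_(i < m.+1) (excess phi (X i w))%:E)%E.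
  exact: emeasurable_sum.
rewrite ge0_integralD//; last 2 first.
- by move=> w _; rewrite mule_ge0.
- exact: measurable_funeM.
rewrite ge0_integralZl_EFin// integral_cst//.
rewrite [X in (_ + _ * X)%E](_ : _ = 1%E) ?mule1; last exact: probability_setT.
rewrite ge0_integral_sum//; last by move=> i w _; rewrite lee_fin.
under eq_bigr do rewrite EX.
rewrite sumEFin sumr_const card_ord -EFinM -EFinD lee_fin addrA !lerD2r.
have J0 : 0 <= J.
  rewrite -lee_fin -JE; apply: integral_ge0 => x _.
  by rewrite lee_fin mulr_ge0// ltW.
by rewrite -[J *+ _]mulr_natl mulrA ler_piMl// mulrC ler_pdivrMr// mul1r ler_nat.
Qed.

End coupling.

(** * The limit *)

(** The two integrands differ by [1 - phi], whose integral is 0. *)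
Lemma integral_excess (R : realType) (phi : R -> R) :
  continuous phi -> (forall x, 0 < phi x) ->
  (\int[@lebesgue_measure R]_(x in `[0%R, 1%R]) (phi x)%:E = 1)%E ->
  exists2 J : R,
   (\int[@lebesgue_measure R]_(x in `[0%R, 1%R]) (excess phi x * phi x)%:E = J%:E)%E &
   (\int[@lebesgue_measure R]_(x in `[0%R, 1%R]) (phi x * ln (phi x))%:E = J%:E)%E.
Proof.
move=> cphi phi_gt0 phi1; set mu := @lebesgue_measure R.
have intc (g : R -> R) : continuous g -> mu.-integrable `[0, 1] (EFin \o g).
  move=> cg; apply: continuous_compact_integrable; first exact: segment_compact.
  exact: continuous_subspaceT.
have iphiln : mu.-integrable `[0, 1] (EFin \o (fun x => phi x * ln (phi x))).
  apply: intc => x; apply: cvgM; first exact: cphi.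
  by apply: continuous_comp; [exact: cphi|exact: continuous_ln].
have fin : (\int[mu]_(x in `[0%R, 1%R]) (phi x * ln (phi x))%:E)%E \is a fin_num.
  exact: integrable_fin_num.
exists (fine (\int[mu]_(x in `[0%R, 1%R]) (phi x * ln (phi x))%:E)%E); last by rewrite fineK.
rewrite fineK//.
transitivity (\int[mu]_(x in `[0%R, 1%R])
    (1 - (phi x)%:E + (phi x * ln (phi x))%:E))%E.
  apply: eq_integral => x _.
  rewrite -EFinB -EFinD; congr (_%:E); rewrite /excess.
  by field; rewrite gt_eqF.
have i1 : mu.-integrable `[0, 1] (cst 1%:E) by apply: intc => x; exact: cvg_cst.
rewrite integralD//; last first.
  by apply: integrableB => //; exact: intc.
rewrite integralB//; last exact: intc.
rewrite phi1 integral_cst//= lebesgue_measure_itv /= lte_fin ltr01 mul1e.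
by rewrite sube0 subee// add0e.
Qed.

Lemma limn_esup_le_vanishing (R : realType) (u : nat -> \bar R) (l : R) :
  (forall e : R, 0 < e ->
    exists2 K : R, 0 <= K & forall n, (u n <= (l + K / n.+2%:R + e)%:E)%E) ->
  (limn_esup u <= l%:E)%E.
Proof.
move=> h; apply/lee_addgt0Pr => e e0.
have e2 : 0 < e / 2 by rewrite divr_gt0.
have [K K0 uK] := h _ e2.
pose n0 := Num.bound (K / (e / 2)).
apply: (@le_trans _ _ (ereal_sup (u @` [set n | (n0 <= n)%N]))).
  by apply: ereal_inf_lbound; exists [set n | (n0 <= n)%N] => //; exact: nbhs_infty_ge.
apply: ge_ereal_sup => _ [n /= n0n <-]; apply: (le_trans (uK n)).
rewrite -EFinD lee_fin -addrA lerD2l [leRHS]splitr lerD2r.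
rewrite ler_pdivrMr// mulrC -ler_pdivrMr//.
have := archi_boundP (divr_ge0 K0 (ltW e2)) => /ltW/le_trans; apply.
by rewrite ler_nat (leq_trans n0n)// -addn2 leq_addr.
Qed.

Theorem theorem8 (R : realType) (F f : R -> R)
    (f_continuous : {within `[0, 1], continuous f})
    (f_gt0 : forall x, x \in `[0, 1] -> 0 < f x)
    (F_density : forall x, x \in `[0, 1] ->
      (F x)%:E = (\int[@lebesgue_measure R]_(u in `[0%R, x]) (f u)%:E)%E)
    (F0 : F 0 = 0) (F1 : F 1 = 1)
    (d : nat -> measure_display)
    (Omega : forall n : nat, measurableType (d n))
    (Pr : forall n : nat, probability (Omega n) R)
    (X : forall n : nat, 'I_n.+1 -> {RV (Pr n) >-> R})
    (X_iid : forall n : nat, iid_with_cdf01 (X n) F) :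
  (limn_esup (fun n : nat =>
     transport_cost (uniform_simplex n.+1) (gap_law (X n)))
   <= \int[@lebesgue_measure R]_(u in `[0%R, 1%R]) (f u * ln (f u))%:E)%E.
Proof.
have in01 (x : R) : (x \in `[0, 1]) = (0 <= x <= 1) by rewrite in_itv.
pose phi := f \o clamp.
have cphi : continuous phi by exact: continuous_comp_clamp.
have phi_gt0 x : 0 < phi x by apply: f_gt0; rewrite in01 clamp01.
have phi_clamp x : phi (clamp x) = phi x by rewrite /phi /= clamp_id// clamp01.
have phiE x : x \in `[0, 1] -> phi x = f x.
  by rewrite in01 => x01; rewrite /phi /= clamp_id.
have [Phi [PhiE dPhi]] := smooth_extension f_continuous F_density.
have Phi0 : Phi 0 = 0 by rewrite PhiE// in01 lexx ler01.
have Phi1 : Phi 1 = 1 by rewrite PhiE// in01 lexx ler01.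
have int_phi : (\int[@lebesgue_measure R]_(x in `[0%R, 1%R]) (phi x)%:E = 1)%E.
  have := F_density 1; rewrite F1 in01 lexx ler01 => /(_ isT) ->.
  by apply: eq_integral => x /set_mem /= /phiE ->.
have [J JE JfE] := integral_excess cphi phi_gt0 int_phi.
have fE : (\int[@lebesgue_measure R]_(u in `[0%R, 1%R]) (f u * ln (f u))%:E = J%:E)%E.
  by rewrite -JfE; apply: eq_integral => x /set_mem /= /phiE ->.
rewrite fE.
have X_iid' n : iid_with_cdf01 (X n) Phi.
  have [ind cdfX] := X_iid n; split => // i x x01.
  by rewrite cdfX// PhiE.
apply: limn_esup_le_vanishing => e e0.
have [C C0 excessC] := continuous_le_lipschitz (continuous_excess cphi phi_gt0) e0.
exists (excess phi 1 + C); first by rewrite addr_ge0// excess_ge0.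
move=> n.
exact: (transport_cost_le cphi phi_gt0 phi_clamp dPhi Phi0 Phi1 (X_iid' n) (ltW e0)
  C0 excessC JE).
Qed.
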